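(* Let $K\to R$ be a homomorphism of commutative rings, and let $R\to S_l$, $1\le l\le n$, be a finite collection of homomorphisms of commutative rings such that the collection of induced maps of the spectra $\mathrm{Spec}\,S_l\to\mathrm{Spec}\,R$ is an affine open covering of the affine scheme $\mathrm{Spec}\,R$. Let $U$ be a contraadjusted $R$-module and $V$ be an $R$-module. Let $D_l\colon\mathrm{Hom}_R(S_l,U)\to\mathrm{Hom}_R(S_l,V)$ be $K$-linear $S_l$-differential operators, defined for all indices $1\le l\le n$. For every pair of indices $j$ and $l$, put $S_{jl}=S_j\otimes_RS_l$. Assume that, for every pair of indices $j$ and $l$, the $S_{jl}$-differential operator $D_{jl}\colon\mathrm{Hom}_R(S_{jl},U)\to\mathrm{Hom}_R(S_{jl},V)$ induced by $D_j$ is equal (under the identification $S_{jl}\simeq S_{lj}$) to the $S_{lj}$-differential operator $D_{lj}\colon\mathrm{Hom}_R(S_{lj},U)\to\mathrm{Hom}_R(S_{lj},V)$ induced by $D_l$. Then there exists a unique $K$-linear $R$-differential operator $D\colon U\to V$ such that, for every index $l$, the $S_l$-differential operator $D_l$ is induced by $D$.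
   Context: An $R$-module $C$ over a commutative ring $R$ is contraadjusted if $\mathrm{Ext}^1_R(R[r^{-1}],C)=0$ for every $r\in R$. For a homomorphism of commutative rings $K\to R$ and $R$-modules $U$, $V$, the group $E=\mathrm{Hom}_K(U,V)$ is an $R$-$R$-bimodule: $(re)(u)=r\,e(u)$, $(er)(u)=e(ru)$. For $r\in R$ put $\theta_r(e)=re-er$. A $K$-linear map $e\colon U\to V$ is a $K$-linear $R$-differential operator if for every $r\in R$ there exists an integer $n\ge0$ such that $(\theta_r)^{n+1}(e)=0$. Induced operators: if $A\to A'$ is a flat epimorphism of commutative $K$-algebras (an epimorphism in commutative rings with $A'$ flat over $A$), $M$, $N$ are $A$-modules and $D\colon M\to N$ is a $K$-linear $A$-differential operator, then there is a unique $K$-linear $A'$-differential operator $D'\colon\mathrm{Hom}_A(A',M)\to\mathrm{Hom}_A(A',N)$ with $D'(g)(1)=D(g(1))$ for all $g\in\mathrm{Hom}_A(A',M)$; it is said to be induced by $D$. (Here $\mathrm{Hom}_A(A',M)$ is an $A'$-module via $(sg)(t)=g(st)$.) This is applied to $R\to S_l$ and to $S_l\to S_{jl}$, $S_j\to S_{jl}$, with the identifications $\mathrm{Hom}_{S_l}(S_{jl},\mathrm{Hom}_R(S_l,U))=\mathrm{Hom}_R(S_{jl},U)$, etc. An affine open covering means that every $\mathrm{Spec}\,S_l\to\mathrm{Spec}\,R$ is an open immersion and the images cover $\mathrm{Spec}\,R$ (so $R\to S_l$ are flat epimorphisms). *)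

(* Defs.v *)
From HB Require Import structures.
From mathcomp Require Import all_boot all_algebra ring.
From mathcomp Require Import boolp classical_sets topology.

Set Implicit Arguments.
Unset Strict Implicit.
Unset Printing Implicit Defensive.

Import GRing.Theory.
Local Open Scope ring_scope.
Local Open Scope quotient_scope.
Local Open Scope classical_set_scope.

(* Rings are [comPzRingType]: commutative, unital, possibly zero (a          *)
(* localization or a tensor product of nonzero rings may vanish).            *)

Definition rcomp (A B C : comPzRingType)
    (f : {rmorphism A -> B}) (g : {rmorphism B -> C}) : {rmorphism A -> C} :=
  g \o f.

(* Restriction of scalars along phi; phi is a phantom argument of the carrier *)
(* that selects the A-module structure.                                       *)
Definition restr (A B : comPzRingType) (phi : {rmorphism A -> B})
  (M : lmodType B) : Type := M.

Section Restriction.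
Variables (A B : comPzRingType) (phi : {rmorphism A -> B}) (M : lmodType B).
Local Notation restr := (restr phi M).

HB.instance Definition _ := GRing.Zmodule.copy restr M.

Let sc (a : A) (x : restr) : restr := phi a *: (x : M).

Let scA a b v : sc a (sc b v) = sc (a * b) v.
Proof. by rewrite /sc scalerA rmorphM. Qed.

Let sc1 : left_id 1 sc.
Proof. by move=> v; rewrite /sc rmorph1 scale1r. Qed.

Let scDr : right_distributive sc +%R.
Proof. by move=> a u v; exact: scalerDr. Qed.

Let scDl v : {morph sc^~ v : a b / a + b}.
Proof. by move=> a b; rewrite /sc rmorphD scalerDl. Qed.

HB.instance Definition _ :=
  GRing.Zmodule_isLmodule.Build A restr scA sc1 scDr scDl.

Lemma restr_scaleE (a : A) (x : M) : a *: (x : restr) = phi a *: x.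
Proof. by []. Qed.

End Restriction.

(* Hom_A(B, M), with the B-module structure (s g)(t) = g (s t). *)
Record coind (A B : comPzRingType) (phi : {rmorphism A -> B}) (M : lmodType A) :=
  Coind {
    coind_fun :> B -> M;
    coind_linear : linear (coind_fun : restr phi B^o -> M)
  }.

Section Coinduced.
Variables (A B : comPzRingType) (phi : {rmorphism A -> B}) (M : lmodType A).
Local Notation coind := (coind phi M).

HB.instance Definition _ := gen_eqMixin coind.
HB.instance Definition _ := gen_choiceMixin coind.

Lemma coindP (g h : coind) : g =1 h -> g = h.
Proof.
case: g h => g gP [h hP] /= /funext e; case: _ / e in hP *.
by rewrite (Prop_irrelevance gP hP).
Qed.

Lemma coindE (g : coind) (a : A) (x y : B) :
  g (phi a * x + y) = a *: g x + g y.
Proof. exact: coind_linear. Qed.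

Lemma coindD (g : coind) (x y : B) : g (x + y) = g x + g y.
Proof. by have := coindE g 1 x y; rewrite rmorph1 mul1r scale1r. Qed.

Lemma coindZ (g : coind) (a : A) (x : B) : g (phi a * x) = a *: g x.
Proof.
have g0 : g 0 = 0 by apply: (addrI (g 0)); rewrite -coindD !addr0.
by rewrite -[phi a * x]addr0 coindE g0 addr0.
Qed.

Let add_subproof (g h : coind) (a : A) (x y : B) :
  g (phi a * x + y) + h (phi a * x + y)
    = a *: (g x + h x) + (g y + h y).
Proof. by rewrite !coindE scalerDr addrACA. Qed.

Let zero_subproof (a : A) (x y : B) : 0 = a *: (0 : M) + 0.
Proof. by rewrite scaler0 addr0. Qed.

Let opp_subproof (g : coind) (a : A) (x y : B) :
  - g (phi a * x + y) = a *: (- g x) + (- g y).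
Proof. by rewrite coindE opprD scalerN. Qed.

Let scale_subproof (s : B) (g : coind) (a : A) (x y : B) :
  g (s * (phi a * x + y)) = a *: g (s * x) + g (s * y).
Proof. by rewrite mulrDr mulrCA coindE. Qed.

Let add (g h : coind) : coind := Coind (add_subproof g h).
Let zero : coind := Coind zero_subproof.
Let opp (g : coind) : coind := Coind (opp_subproof g).
Let scale (s : B) (g : coind) : coind := Coind (scale_subproof s g).

Let addA : associative add.
Proof. by move=> g h k; apply: coindP => t; apply: addrA. Qed.
Let addC : commutative add.
Proof. by move=> g h; apply: coindP => t; apply: addrC. Qed.
Let add0 : left_id zero add.
Proof. by move=> g; apply: coindP => t; apply: add0r. Qed.
Let addN : left_inverse zero opp add.
Proof. by move=> g; apply: coindP => t; apply: addNr. Qed.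

HB.instance Definition _ := GRing.isZmodule.Build coind addA addC add0 addN.

Let scaleA a b v : scale a (scale b v) = scale (a * b) v.
Proof. by apply: coindP => t; rewrite /= mulrCA mulrA. Qed.
Let scale1 : left_id 1 scale.
Proof. by move=> v; apply: coindP => t; rewrite /= mul1r. Qed.
Let scaleDr : right_distributive scale +%R.
Proof. by move=> a u v; apply: coindP. Qed.
Let scaleDl v : {morph scale^~ v : a b / a + b}.
Proof.
by move=> a b; apply: coindP => t; rewrite /= mulrDl coindD.
Qed.

HB.instance Definition _ :=
  GRing.Zmodule_isLmodule.Build B coind scaleA scale1 scaleDr scaleDl.

Lemma coind_addE (g h : coind) t : (g + h) t = g t + h t.
Proof. by []. Qed.

Lemma coind_scaleE (s : B) (g : coind) t : (s *: g) t = g (s * t).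
Proof. by []. Qed.

End Coinduced.

Section CoinducedMaps.
Variables (A B C : comPzRingType).
Variables (phi : {rmorphism A -> B}) (psi : {rmorphism B -> C}).

(* Hom_B(C, Hom_A(B, M)) = Hom_A(C, M), in both directions. *)
Section Curry.
Variable M : lmodType A.

Let curry1_subproof (h : coind (rcomp phi psi) M) (t : C) (a : A) (x y : B) :
  h (psi (phi a * x + y) * t) = a *: h (psi x * t) + h (psi y * t).
Proof. by rewrite rmorphD rmorphM mulrDl -mulrA; apply: coindE. Qed.

Let curry2_subproof (h : coind (rcomp phi psi) M) (b : B) (t u : C) :
  Coind (curry1_subproof h (psi b * t + u))
    = b *: Coind (curry1_subproof h t) + Coind (curry1_subproof h u).
Proof.
apply: coindP => s; rewrite coind_addE coind_scaleE /=.
by rewrite -coindD rmorphM; congr (h _); ring.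
Qed.

Definition coind_curry (h : coind (rcomp phi psi) M) :
    coind psi (coind phi M) :=
  Coind (curry2_subproof h).

Lemma coind_curryE h t s : coind_curry h t s = h (psi s * t).
Proof. by []. Qed.

Let uncurry_subproof (g : coind psi (coind phi M)) (a : A) (x y : C) :
  g (rcomp phi psi a * x + y) 1 = a *: g x 1 + g y 1.
Proof.
by rewrite [rcomp _ _ a]/(psi (phi a)) coindE coind_addE coind_scaleE coindZ.
Qed.

Definition coind_uncurry (g : coind psi (coind phi M)) :
    coind (rcomp phi psi) M :=
  Coind (uncurry_subproof g).

Lemma coind_uncurryE g t : coind_uncurry g t = g t 1.
Proof. by []. Qed.

Lemma coind_curryK : cancel coind_curry coind_uncurry.
Proof. by move=> h; apply: coindP => t /=; rewrite rmorph1 mul1r. Qed.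

Lemma coind_uncurryK : cancel coind_uncurry coind_curry.
Proof.
move=> g; apply: coindP => t; apply: coindP => s /=.
by rewrite coindZ coind_scaleE mulr1.
Qed.

End Curry.
End CoinducedMaps.

Section Precomposition.
Variables (A B C : comPzRingType).
Variables (phi : {rmorphism A -> B}) (psi : {rmorphism A -> C}).
Variables (s : {rmorphism B -> C}) (sP : forall a, s (phi a) = psi a).
Variable M : lmodType A.

Let precomp_subproof (h : coind psi M) (a : A) (x y : B) :
  h (s (phi a * x + y)) = a *: h (s x) + h (s y).
Proof. by rewrite rmorphD rmorphM sP coindE. Qed.

Definition coind_precomp (h : coind psi M) : coind phi M :=
  Coind (precomp_subproof h).

End Precomposition.

(* The tensor product A (x)_R B of commutative R-algebras. Its elements are   *)
(* classes of finite formal sums of pairs, a list [:: (a1, b1); ...] standing *)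
(* for the sum of the ai (x) bi; [tens_rel] is the congruence generated by    *)
(* commutativity of the sum, biadditivity and (r a) (x) b = a (x) (r b).      *)
Section Tensor.
Variables (R A B : comPzRingType).
Variables (phi : {rmorphism R -> A}) (psi : {rmorphism R -> B}).
Implicit Types (s t : seq (A * B)).

Inductive tens_rel : seq (A * B) -> seq (A * B) -> Prop :=
| tens_refl s : tens_rel s s
| tens_sym s t : tens_rel s t -> tens_rel t s
| tens_trans s t u : tens_rel s t -> tens_rel t u -> tens_rel s u
| tens_cat s s' t t' :
    tens_rel s s' -> tens_rel t t' -> tens_rel (s ++ t) (s' ++ t')
| tens_comm s t : tens_rel (s ++ t) (t ++ s)
| tens_zero b : tens_rel [:: (0, b)] [::]
| tens_addl a a' b : tens_rel [:: (a + a', b)] [:: (a, b); (a', b)]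
| tens_addr a b b' : tens_rel [:: (a, b + b')] [:: (a, b); (a, b')]
| tens_bal r a b : tens_rel [:: (phi r * a, b)] [:: (a, psi r * b)].

Definition tens_eqv s t := `[< tens_rel s t >].

Let tens_eqv_refl : reflexive tens_eqv.
Proof. by move=> s; apply/asboolP; apply: tens_refl. Qed.
Let tens_eqv_sym : symmetric tens_eqv.
Proof. by move=> s t; apply/asboolP/asboolP; apply: tens_sym. Qed.
Let tens_eqv_trans : transitive tens_eqv.
Proof.
move=> t s u /asboolP st /asboolP tu; apply/asboolP; exact: tens_trans st tu.
Qed.

Canonical tens_eqv_equiv :=
  EquivRel tens_eqv tens_eqv_refl tens_eqv_sym tens_eqv_trans.

Definition tens : Type := {eq_quot tens_eqv}.
HB.instance Definition _ := Choice.on tens.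
HB.instance Definition _ := EqQuotient.on tens.

Definition tsum (s : seq (A * B)) : tens := \pi s.

Lemma tsumP s t : tsum s = tsum t <-> tens_rel s t.
Proof. by split=> [/eqmodP/asboolP //|e]; apply/eqmodP; exact/asboolP. Qed.

Lemma tsumK (x : tens) : tsum (repr x) = x.
Proof. exact: reprK. Qed.

Let negs s : seq (A * B) := [seq (- x.1, x.2) | x <- s].
Let mults s t : seq (A * B) := [seq (x.1 * y.1, x.2 * y.2) | x <- s, y <- t].

Let zeror a : tens_rel [:: (a, 0)] [::].
Proof.
apply: tens_trans (tens_zero 0); apply: tens_sym.
by have := tens_bal 0 a 0; rewrite !rmorph0 !mul0r.
Qed.

Let negs_rel s t : tens_rel s t -> tens_rel (negs s) (negs t).
Proof.
rewrite /negs; elim=> {s t} /=.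
- by move=> s; apply: tens_refl.
- by move=> s t _; apply: tens_sym.
- by move=> s t u _ st _; apply: tens_trans st.
- by move=> s s' t t' _ ss' _; rewrite !map_cat; apply: tens_cat.
- by move=> s t; rewrite !map_cat; apply: tens_comm.
- by move=> b; rewrite oppr0; apply: tens_zero.
- by move=> a a' b; rewrite opprD; apply: tens_addl.
- by move=> a b b'; apply: tens_addr.
- by move=> r a b; rewrite -mulrN; apply: tens_bal.
Qed.


Let catAC s t u v : tens_rel ((s ++ t) ++ (u ++ v)) ((s ++ u) ++ (t ++ v)).
Proof.
rewrite -!catA; apply: tens_cat; first exact: tens_refl.
by rewrite !catA; apply: tens_cat; [exact: tens_comm | exact: tens_refl].
Qed.

Let mults_nil s : mults s [::] = [::].
Proof. exact: allpairs0r. Qed.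

Let mults_consl x s t :
  mults (x :: s) t = [seq (x.1 * y.1, x.2 * y.2) | y <- t] ++ mults s t.
Proof. by []. Qed.

Let multsC s t : tens_rel (mults s t) (mults t s).
Proof.
elim: s t => [|x s IHs] t; first by rewrite mults_nil; apply: tens_refl.
rewrite mults_consl.
apply: (@tens_trans _ ([seq (x.1 * y.1, x.2 * y.2) | y <- t] ++ mults t s)).
  by apply: tens_cat; [exact: tens_refl | exact: IHs].
elim: t {IHs} => [|y t IHt]; first by apply: tens_refl.
rewrite !mults_consl /= (mulrC x.1) (mulrC x.2).
set p := (y.1 * x.1, _); set X := map _ t; set Y := map _ s.
rewrite /=; apply: (@tens_cat [:: p] [:: p]); first exact: tens_refl.
apply: (@tens_trans _ (Y ++ (X ++ mults t s))).
  by rewrite !catA; apply: tens_cat; [exact: tens_comm | exact: tens_refl].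
by apply: tens_cat; [exact: tens_refl | exact: IHt].
Qed.

Let mults_rell s t u : tens_rel s t -> tens_rel (mults s u) (mults t u).
Proof.
elim=> {s t} /=.
- by move=> s; apply: tens_refl.
- by move=> s t _; apply: tens_sym.
- by move=> s t v _ st _; apply: tens_trans st.
- by move=> s s' t t' _ ss' _; rewrite /mults !allpairs_cat; apply: tens_cat.
- by move=> s t; rewrite /mults !allpairs_cat; apply: tens_comm.
- move=> b; rewrite /mults /= cats0; elim: u => [|y u IHu] /=.
    exact: tens_refl.
  by rewrite mul0r -cat1s -[X in tens_rel _ X]cat0s; apply: tens_cat;
    [exact: tens_zero | exact: IHu].
- move=> a a' b; rewrite /mults /= cats0; elim: u => [|y u IHu] /=.
    exact: tens_refl.
  rewrite mulrDl -cat1s; apply: tens_trans (tens_cat (tens_addl _ _ _) IHu) _.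
  exact: (catAC [:: _] [:: _]).
- move=> a b b'; rewrite /mults /= cats0; elim: u => [|y u IHu] /=.
    exact: tens_refl.
  rewrite mulrDl -cat1s; apply: tens_trans (tens_cat (tens_addr _ _ _) IHu) _.
  exact: (catAC [:: _] [:: _]).
- move=> r a b; rewrite /mults /= !cats0; elim: u => [|y u IHu] /=.
    exact: tens_refl.
  rewrite -!mulrA -cat1s -[X in tens_rel _ X]cat1s; apply: tens_cat IHu.
  exact: tens_bal.
Qed.

Let mults_rel s s' t t' :
  tens_rel s s' -> tens_rel t t' -> tens_rel (mults s t) (mults s' t').
Proof.
move=> ss' tt'; apply: tens_trans (mults_rell t ss') _.
apply: tens_trans (multsC _ _) _; apply: tens_trans (multsC _ _).
exact: mults_rell.
Qed.

Let add (x y : tens) : tens := tsum (repr x ++ repr y).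
Let opp (x : tens) : tens := tsum (negs (repr x)).
Let mul (x y : tens) : tens := tsum (mults (repr x) (repr y)).
Let zero : tens := tsum [::].
Let one : tens := tsum [:: (1, 1)].

Let addE s t : add (tsum s) (tsum t) = tsum (s ++ t).
Proof. by apply/tsumP/tens_cat; apply/tsumP; rewrite tsumK. Qed.
Let oppE s : opp (tsum s) = tsum (negs s).
Proof. by apply/tsumP/negs_rel; apply/tsumP; rewrite tsumK. Qed.
Let mulE s t : mul (tsum s) (tsum t) = tsum (mults s t).
Proof. by apply/tsumP/mults_rel; apply/tsumP; rewrite tsumK. Qed.

Let addA : associative add.
Proof.
by move=> x y z; rewrite -(tsumK x) -(tsumK y) -(tsumK z) !addE catA.
Qed.
Let addC : commutative add.
Proof.
move=> x y; rewrite -(tsumK x) -(tsumK y) !addE; apply/tsumP/tens_comm.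
Qed.
Let add0 : left_id zero add.
Proof. by move=> x; rewrite -(tsumK x) addE. Qed.
Let addN : left_inverse zero opp add.
Proof.
move=> x; rewrite -(tsumK x) oppE addE; apply/tsumP.
elim: (repr x) => [|[a b] s IHs] /=; first exact: tens_refl.
rewrite -cat1s -[(a, b) :: s]cat1s.
apply: tens_trans (catAC [:: _] _ [:: _] _) _.
rewrite -[X in tens_rel _ X]cat0s; apply: tens_cat IHs.
apply: tens_trans (tens_zero b); rewrite -(addNr a).
exact/tens_sym/tens_addl.
Qed.

HB.instance Definition _ := GRing.isZmodule.Build tens addA addC add0 addN.

Let mulA : associative mul.
Proof.
move=> x y z; rewrite -(tsumK x) -(tsumK y) -(tsumK z) !mulE; congr tsum.
elim: (repr x) => [//|a s IHs]; rewrite !mults_consl /mults allpairs_cat.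
congr (_ ++ _); last exact: IHs.
elim: (repr y) => [//|b t IHt] /=; rewrite map_cat IHt; congr (_ ++ _).
by rewrite -map_comp; apply: eq_map => c /=; rewrite !mulrA.
Qed.
Let mulC : commutative mul.
Proof.
by move=> x y; rewrite -(tsumK x) -(tsumK y) !mulE; apply/tsumP/multsC.
Qed.
Let mul1 : left_id one mul.
Proof.
move=> x; rewrite -(tsumK x) mulE /mults /= cats0; congr tsum.
by rewrite -[RHS]map_id; apply: eq_map => -[a b] /=; rewrite !mul1r.
Qed.
Let mulDl : left_distributive mul add.
Proof.
move=> x y z; rewrite -(tsumK x) -(tsumK y) -(tsumK z) !(addE, mulE).
by rewrite /mults allpairs_cat.
Qed.

HB.instance Definition _ :=
  GRing.Zmodule_isComPzRing.Build tens mulA mulC mul1 mulDl.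

Lemma tsum_cat s t : tsum (s ++ t) = tsum s + tsum t.
Proof. by rewrite -addE. Qed.

Lemma tsum_mul s t : tsum s * tsum t
  = tsum [seq (x.1 * y.1, x.2 * y.2) | x <- s, y <- t].
Proof. exact: mulE. Qed.

Definition tpure (a : A) (b : B) : tens := tsum [:: (a, b)].

Lemma tpureDl a a' b : tpure (a + a') b = tpure a b + tpure a' b.
Proof. by rewrite -tsum_cat; apply/tsumP/tens_addl. Qed.

Lemma tpureDr a b b' : tpure a (b + b') = tpure a b + tpure a b'.
Proof. by rewrite -tsum_cat; apply/tsumP/tens_addr. Qed.

Lemma tpure_bal r a b : tpure (phi r * a) b = tpure a (psi r * b).
Proof. exact/tsumP/tens_bal. Qed.

Lemma tpureM a a' b b' : tpure a b * tpure a' b' = tpure (a * a') (b * b').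
Proof. by rewrite tsum_mul. Qed.

Lemma tsumE s : tsum s = \sum_(x <- s) tpure x.1 x.2.
Proof.
elim: s => [|[a b] s IHs]; first by rewrite big_nil.
by rewrite big_cons -cat1s tsum_cat IHs.
Qed.

Let inl_fun (a : A) : tens := tpure a 1.
Let inr_fun (b : B) : tens := tpure 1 b.

Let inl_additive : zmod_morphism inl_fun.
Proof.
move=> a b; apply/eqP; rewrite eq_sym subr_eq; apply/eqP.
by rewrite /inl_fun -tpureDl subrK.
Qed.
Let inr_additive : zmod_morphism inr_fun.
Proof.
move=> a b; apply/eqP; rewrite eq_sym subr_eq; apply/eqP.
by rewrite /inr_fun -tpureDr subrK.
Qed.
Let inl_multiplicative : monoid_morphism inl_fun.
Proof. by split=> // a b; rewrite /inl_fun tpureM mulr1. Qed.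
Let inr_multiplicative : monoid_morphism inr_fun.
Proof. by split=> // a b; rewrite /inr_fun tpureM mulr1. Qed.

HB.instance Definition _ :=
  GRing.isZmodMorphism.Build A tens inl_fun inl_additive.
HB.instance Definition _ :=
  GRing.isMonoidMorphism.Build A tens inl_fun inl_multiplicative.
HB.instance Definition _ :=
  GRing.isZmodMorphism.Build B tens inr_fun inr_additive.
HB.instance Definition _ :=
  GRing.isMonoidMorphism.Build B tens inr_fun inr_multiplicative.

Definition tens_inl : {rmorphism A -> tens} := inl_fun.
Definition tens_inr : {rmorphism B -> tens} := inr_fun.

Lemma tens_inlE a : tens_inl a = tpure a 1. Proof. by []. Qed.
Lemma tens_inrE b : tens_inr b = tpure 1 b. Proof. by []. Qed.

Lemma tens_inlr r : tens_inl (phi r) = tens_inr (psi r).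
Proof. by have := tpure_bal r 1 1; rewrite !mulr1. Qed.

End Tensor.

(* A (x)_R B -> B (x)_R A, a (x) b |-> b (x) a *)
Section TensorSwap.
Variables (R A B : comPzRingType).
Variables (phi : {rmorphism R -> A}) (psi : {rmorphism R -> B}).

Let swaps (s : seq (A * B)) : seq (B * A) := [seq (x.2, x.1) | x <- s].

Let swaps_rel s t : tens_rel phi psi s t -> tens_rel psi phi (swaps s) (swaps t).
Proof.
rewrite /swaps; elim=> {s t} /=.
- by move=> s; apply: tens_refl.
- by move=> s t _; apply: tens_sym.
- by move=> s t u _ st _; apply: tens_trans st.
- by move=> s s' t t' _ ss' _; rewrite !map_cat; apply: tens_cat.
- by move=> s t; rewrite !map_cat; apply: tens_comm.
- move=> b; apply: tens_trans (tens_zero _ _ 0); apply: tens_sym.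
  by have := tens_bal psi phi 0 b 0; rewrite !rmorph0 !mul0r.
- by move=> a a' b; apply: tens_addr.
- by move=> a b b'; apply: tens_addl.
- by move=> r a b; apply/tens_sym/tens_bal.
Qed.

Let swap_fun (x : tens phi psi) : tens psi phi := tsum psi phi (swaps (repr x)).

Let swapE s : swap_fun (tsum phi psi s) = tsum psi phi (swaps s).
Proof. by apply/tsumP/swaps_rel; apply/tsumP; rewrite tsumK. Qed.

Let swapD x y : swap_fun (x + y) = swap_fun x + swap_fun y.
Proof.
rewrite -(tsumK x) -(tsumK y) -tsum_cat !swapE -tsum_cat.
by rewrite /swaps map_cat.
Qed.

Let swap_additive : zmod_morphism swap_fun.
Proof.
move=> x y; apply/eqP; rewrite eq_sym subr_eq; apply/eqP.
by rewrite -swapD subrK.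
Qed.
Let swap_multiplicative : monoid_morphism swap_fun.
Proof.
split=> [|x y]; first exact: (swapE [:: (1, 1)]).
rewrite -(tsumK x) -(tsumK y) tsum_mul !swapE tsum_mul; congr tsum.
by rewrite /swaps map_allpairs allpairs_mapl allpairs_mapr.
Qed.

HB.instance Definition _ :=
  GRing.isZmodMorphism.Build (tens phi psi) (tens psi phi) swap_fun
    swap_additive.
HB.instance Definition _ :=
  GRing.isMonoidMorphism.Build (tens phi psi) (tens psi phi) swap_fun
    swap_multiplicative.

Definition tens_swap : {rmorphism tens phi psi -> tens psi phi} := swap_fun.

Lemma tens_swapE a b : tens_swap (tpure phi psi a b) = tpure psi phi b a.
Proof. exact: (swapE [:: (a, b)]). Qed.

Lemma tens_swap_inl r :
  tens_swap (rcomp phi (tens_inl phi psi) r) = rcomp psi (tens_inl psi phi) r.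
Proof.
transitivity (tpure psi phi 1 (phi r)); first exact: tens_swapE.
by rewrite -tens_inrE -tens_inlr.
Qed.

End TensorSwap.

Lemma tens_swapK (R A B : comPzRingType)
    (phi : {rmorphism R -> A}) (psi : {rmorphism R -> B}) :
  cancel (tens_swap phi psi) (tens_swap psi phi).
Proof.
move=> x; rewrite -(tsumK x) tsumE !rmorph_sum.
by apply: eq_bigr => x' _; rewrite !tens_swapE.
Qed.

(* The identification Hom_R(B (x)_R A, M) = Hom_R(A (x)_R B, M) given by the   *)
(* swap A (x)_R B -> B (x)_R A.                                               *)
Definition coind_swap (R A B : comPzRingType)
    (phi : {rmorphism R -> A}) (psi : {rmorphism R -> B}) (M : lmodType R)
    (h : coind (rcomp psi (tens_inl psi phi)) M) :
    coind (rcomp phi (tens_inl phi psi)) M :=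
  coind_precomp (tens_swap_inl phi psi) h.

(* [f] is the structure map of the K-algebra R. *)
Section DiffOp.
Variables (K R : comPzRingType) (f : {rmorphism K -> R}) (U V : lmodType R).

(* theta_r(e) = r e - e r *)
Definition theta (r : R) (e : U -> V) : U -> V :=
  fun u => r *: e u - e (r *: u).

Definition diffop (D : U -> V) : Prop :=
  linear (D : restr f U -> restr f V) /\
  forall r : R, exists n : nat, forall u : U, iter n.+1 (theta r) D u = 0.

End DiffOp.

(* [f] is the structure map of the K-algebra A; D' is K-linear along f phi.  *)
Definition induced (K A A' : comPzRingType) (f : {rmorphism K -> A})
    (phi : {rmorphism A -> A'}) (M N : lmodType A)
    (D : M -> N) (D' : coind phi M -> coind phi N) : Prop :=
  diffop (rcomp f phi) D' /\ forall g : coind phi M, D' g 1 = D (g 1).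

Arguments induced {K A A'} f phi {M N} D D'.

(* The localization of R at a multiplicative subset M: fractions a/s with    *)
(* a/s = b/t iff u a t = u b s for some u in M.                              *)
Section Localization.
Variables (R : comPzRingType) (M : mulrClosed R).

Definition frac_pair := (R * {s : R | s \in M})%type.
Implicit Types x y z : frac_pair.

Definition frac_eqv x y :=
  `[< exists2 u : R, u \in M & u * (x.1 * sval y.2) = u * (y.1 * sval x.2) >].

Let frac_eqv_refl : reflexive frac_eqv.
Proof. by move=> x; apply/asboolP; exists 1 => //; apply: rpred1. Qed.

Let frac_eqv_sym : symmetric frac_eqv.
Proof.
by move=> x y; apply/asboolP/asboolP => -[u uM e]; exists u.
Qed.

Let frac_eqv_trans : transitive frac_eqv.
Proof.
move=> y x z /asboolP[u uM e] /asboolP[v vM e']; apply/asboolP.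
exists (u * v * sval y.2); first by rewrite !rpredM ?(valP y.2).
have -> : u * v * sval y.2 * (x.1 * sval z.2)
  = u * (x.1 * sval y.2) * (v * sval z.2) by ring.
have -> : u * v * sval y.2 * (z.1 * sval x.2)
  = v * (z.1 * sval y.2) * (u * sval x.2) by ring.
by rewrite e -e'; ring.
Qed.

Canonical frac_eqv_equiv :=
  EquivRel frac_eqv frac_eqv_refl frac_eqv_sym frac_eqv_trans.

Definition loc : Type := {eq_quot frac_eqv}.
HB.instance Definition _ := Choice.on loc.
HB.instance Definition _ := EqQuotient.on loc.

Definition frac (x : frac_pair) : loc := \pi x.

Lemma fracP x y : frac x = frac y <->
  exists2 u : R, u \in M & u * (x.1 * sval y.2) = u * (y.1 * sval x.2).
Proof.
split=> [/eqmodP/asboolP //|e]; apply/eqmodP; exact/asboolP.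
Qed.

Lemma fracK (q : loc) : frac (repr q) = q.
Proof. exact: reprK. Qed.

Let denM_subproof (s t : {s : R | s \in M}) : sval s * sval t \in M.
Proof. exact: rpredM (valP s) (valP t). Qed.

Definition denM (s t : {s : R | s \in M}) : {s : R | s \in M} :=
  exist _ (sval s * sval t) (denM_subproof s t).
Definition den1 : {s : R | s \in M} := exist _ 1 (rpred1 M).

Let addp x y : frac_pair :=
  (x.1 * sval y.2 + y.1 * sval x.2, denM x.2 y.2).
Let mulp x y : frac_pair := (x.1 * y.1, denM x.2 y.2).
Let oppp x : frac_pair := (- x.1, x.2).

Let add (p q : loc) : loc := frac (addp (repr p) (repr q)).
Let mul (p q : loc) : loc := frac (mulp (repr p) (repr q)).
Let opp (p : loc) : loc := frac (oppp (repr p)).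
Let zero : loc := frac (0, den1).
Let one : loc := frac (1, den1).

Let addE x y : add (frac x) (frac y) = frac (addp x y).
Proof.
have /fracP[u uM e] := fracK (frac x); have /fracP[v vM e'] := fracK (frac y).
apply/fracP; exists (u * v); first exact: rpredM.
move: (repr (frac x)) (repr (frac y)) e e' => x' y' e e' /=.
transitivity (u * (x'.1 * sval x.2) * (v * sval y'.2 * sval y.2)
   + v * (y'.1 * sval y.2) * (u * sval x'.2 * sval x.2)); first by ring.
by rewrite e e'; ring.
Qed.

Let mulE x y : mul (frac x) (frac y) = frac (mulp x y).
Proof.
have /fracP[u uM e] := fracK (frac x); have /fracP[v vM e'] := fracK (frac y).
apply/fracP; exists (u * v); first exact: rpredM.
move: (repr (frac x)) (repr (frac y)) e e' => x' y' e e' /=.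
transitivity (u * (x'.1 * sval x.2) * (v * (y'.1 * sval y.2))); first by ring.
by rewrite e e'; ring.
Qed.

Let oppE x : opp (frac x) = frac (oppp x).
Proof.
have /fracP[u uM e] := fracK (frac x); apply/fracP; exists u => //=.
by rewrite !mulNr !mulrN e.
Qed.

Let frac_eq x y : x.1 * sval y.2 = y.1 * sval x.2 -> frac x = frac y.
Proof. by move=> e; apply/fracP; exists 1; rewrite ?rpred1 ?e. Qed.

Let addA : associative add.
Proof.
move=> p q r; rewrite -(fracK p) -(fracK q) -(fracK r) !addE.
by apply: frac_eq => /=; ring.
Qed.
Let addC : commutative add.
Proof.
move=> p q; rewrite -(fracK p) -(fracK q) !addE.
by apply: frac_eq => /=; ring.
Qed.
Let add0 : left_id zero add.
Proof. by move=> p; rewrite -(fracK p) addE; apply: frac_eq => /=; ring. Qed.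
Let addN : left_inverse zero opp add.
Proof.
by move=> p; rewrite -(fracK p) oppE addE; apply: frac_eq => /=; ring.
Qed.

HB.instance Definition _ := GRing.isZmodule.Build loc addA addC add0 addN.

Let mulA : associative mul.
Proof.
move=> p q r; rewrite -(fracK p) -(fracK q) -(fracK r) !mulE.
by apply: frac_eq => /=; ring.
Qed.
Let mulC : commutative mul.
Proof.
move=> p q; rewrite -(fracK p) -(fracK q) !mulE.
by apply: frac_eq => /=; ring.
Qed.
Let mul1 : left_id one mul.
Proof. by move=> p; rewrite -(fracK p) mulE; apply: frac_eq => /=; ring. Qed.
Let mulDl : left_distributive mul add.
Proof.
move=> p q r; rewrite -(fracK p) -(fracK q) -(fracK r).
by rewrite !(addE, mulE); apply: frac_eq => /=; ring.
Qed.

HB.instance Definition _ :=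
  GRing.Zmodule_isComPzRing.Build loc mulA mulC mul1 mulDl.

Lemma frac_addE x y : frac x + frac y
  = frac (x.1 * sval y.2 + y.1 * sval x.2, denM x.2 y.2).
Proof. exact: addE. Qed.

Lemma frac_mulE x y : frac x * frac y = frac (x.1 * y.1, denM x.2 y.2).
Proof. exact: mulE. Qed.

Let inj_fun (a : R) : loc := frac (a, den1).

Let inj_additive : zmod_morphism inj_fun.
Proof.
move=> a b; rewrite /inj_fun.
transitivity (add (frac (a, den1)) (opp (frac (b, den1)))); last by [].
by rewrite oppE addE; apply: frac_eq => /=; ring.
Qed.

Let inj_multiplicative : monoid_morphism inj_fun.
Proof.
by split=> // a b; rewrite /inj_fun frac_mulE; apply: frac_eq => /=; ring.
Qed.

HB.instance Definition _ :=
  GRing.isZmodMorphism.Build R loc inj_fun inj_additive.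
HB.instance Definition _ :=
  GRing.isMonoidMorphism.Build R loc inj_fun inj_multiplicative.

Definition loc_inj : {rmorphism R -> loc} := inj_fun.

End Localization.

(* The map of localizations a/s |-> phi(a)/phi(s). *)
Section LocalizationMap.
Variables (A B : comPzRingType) (phi : {rmorphism A -> B}).
Variables (M : mulrClosed A) (N : mulrClosed B).
Hypothesis MN : forall x, x \in M -> phi x \in N.

Let map_pair (x : frac_pair M) : frac_pair N :=
  (phi x.1, exist _ (phi (sval x.2)) (MN (valP x.2))).

Definition loc_map (q : loc M) : loc N := frac (map_pair (repr q)).

Lemma loc_mapE (x : frac_pair M) : loc_map (frac x)
  = frac (phi x.1, exist _ (phi (sval x.2)) (MN (valP x.2))).
Proof.
have /fracP[u uM e] := fracK (frac x); apply/fracP.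
by exists (phi u) => /=; [exact: MN | rewrite -!rmorphM e].
Qed.

End LocalizationMap.

Section LocalizationAtElement.
Variables (R : comPzRingType) (r : R).

Definition powers : {pred R} := fun x => `[< exists n : nat, x = r ^+ n >].

Let powersP : mulr_closed powers.
Proof.
split=> [|x y /asboolP[m ->] /asboolP[n ->]]; apply/asboolP.
  by exists 0%N.
by exists (m + n)%N; rewrite exprD.
Qed.

HB.instance Definition _ := GRing.isMulClosed.Build R powers powersP.

Definition loc_elt : comPzRingType := loc powers.

Definition loc_elt_inj : {rmorphism R -> loc_elt} := loc_inj powers.

Definition loc_elt_mod : lmodType R := restr loc_elt_inj loc_elt^o.

End LocalizationAtElement.

Definition prime_ideal (R : comPzRingType) (p : set R) : Prop :=
  [/\ p 0, (forall x y, p x -> p y -> p (x + y)),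
      (forall a x, p x -> p (a * x)), ~ p 1 &
      (forall x y, p (x * y) -> p x \/ p y)].

Record Spec (R : comPzRingType) :=
  MkSpec { spec_set :> set R; specP : prime_ideal spec_set }.

Section SpecTopology.
Variable R : comPzRingType.

HB.instance Definition _ := gen_eqMixin (Spec R).
HB.instance Definition _ := gen_choiceMixin (Spec R).

(* U is open iff its complement is V(E) = {p | E `<=` p} for some E. *)
Definition zariski_open (U : set (Spec R)) : Prop :=
  exists E : set R, U = [set p | ~ E `<=` p].

Let zariski_openT : zariski_open setT.
Proof.
exists setT; apply/seteqP; split=> p //= _ h.
by case: (specP p) => _ _ _ + _; apply; apply: h.
Qed.

Let zariski_openI : setI_closed zariski_open.
Proof.
move=> _ _ [E ->] [F ->]; exists [set x | exists a b, [/\ E a, F b & x = a * b]].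
apply/seteqP; split=> p /=.
  move=> [/existsNP[a /not_implyP[Ea pa]] /existsNP[b /not_implyP[Fb pb]]] h.
  case: (specP p) => _ _ _ _ /(_ a b); case=> //.
  by apply: h; exists a, b.
case: (specP p) => _ _ pM _ _ h; split=> hE; apply: h => _ [a] [b] [Ea Fb ->].
  by rewrite mulrC; apply: pM; apply: hE.
by apply: pM; apply: hE.
Qed.

Let zariski_open_bigU (I : Type) (F : I -> set (Spec R)) :
  (forall i, zariski_open (F i)) -> zariski_open (\bigcup_i F i).
Proof.
move=> /choice[E EP]; exists (\bigcup_i E i); apply/seteqP; split=> p /=.
  by move=> [i _]; rewrite EP /= => h hE; apply: h => x Ex; apply: hE; exists i.
move=> /existsNP[x /not_implyP[[i _ Ex] px]]; exists i => //.
by rewrite EP /= => h; apply/px/h.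
Qed.

HB.instance Definition _ := isOpenTopological.Build (Spec R)
  zariski_openT zariski_openI zariski_open_bigU.

End SpecTopology.

Section SpecMap.
Variables (A B : comPzRingType) (phi : {rmorphism A -> B}).

Let spec_map_subproof (q : Spec B) : prime_ideal (phi @^-1` q).
Proof.
case: (specP q) => q0 qD qM q1 qp; split=> /=.
- by rewrite rmorph0.
- by move=> x y; rewrite rmorphD; apply: qD.
- by move=> a x; rewrite rmorphM; apply: qM.
- by rewrite rmorph1.
- by move=> x y; rewrite rmorphM; apply: qp.
Qed.

Definition spec_map (q : Spec B) : Spec A := MkSpec (spec_map_subproof q).

End SpecMap.

(* The stalk at p of the structure sheaf of Spec R is the local ring R_p.     *)
Section Stalk.
Variables (R : comPzRingType) (p : Spec R).

Definition prime_compl : {pred R} := fun x => `[< ~ spec_set p x >].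

Let prime_complP : mulr_closed prime_compl.
Proof.
case: (specP p) => _ _ _ p1 pP; split=> [|x y /asboolP px /asboolP py].
  exact/asboolP.
by apply/asboolP => /pP[].
Qed.

HB.instance Definition _ := GRing.isMulClosed.Build R prime_compl prime_complP.

Definition stalk : comPzRingType := loc prime_compl.

End Stalk.

Section StalkMap.
Variables (A B : comPzRingType) (phi : {rmorphism A -> B}) (q : Spec B).

Let stalk_map_subproof x :
  x \in prime_compl (spec_map phi q) -> phi x \in prime_compl q.
Proof. by []. Qed.

Definition stalk_map : stalk (spec_map phi q) -> stalk q :=
  loc_map stalk_map_subproof.

End StalkMap.

Arguments stalk_map {A B} phi q _.

(* Spec B -> Spec A is a homeomorphism onto an open subset of Spec A and the  *)
(* maps it induces on the stalks of the structure sheaves are isomorphisms.   *)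
Definition open_immersion (A B : comPzRingType) (phi : {rmorphism A -> B}) :=
  [/\ injective (spec_map phi), continuous (spec_map phi),
      (forall W : set (Spec B), open W -> open (spec_map phi @` W)) &
      (forall q : Spec B, bijective (stalk_map phi q))].

Definition affine_open_covering (R : comPzRingType) (n : nat)
    (S : 'I_n -> comPzRingType) (phi : forall l, {rmorphism R -> S l}) :=
  (forall l, open_immersion (phi l)) /\
  (\bigcup_l range (spec_map (phi l)) = setT).

Definition projective (R : comPzRingType) (P : lmodType R) : Prop :=
  forall (X Y : lmodType R) (g : {linear X -> Y}) (h : {linear P -> Y}),
    (forall y, exists x, g x = y) ->
    exists k : {linear P -> X}, forall p, g (k p) = h p.

Record proj_resolution (R : comPzRingType) (X : lmodType R) := ProjResolution {
  res_obj : nat -> lmodType R;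
  res_diff : forall i, {linear res_obj i.+1 -> res_obj i};
  res_aug : {linear res_obj 0 -> X};
  res_proj : forall i, projective (res_obj i);
  res_aug_surj : forall x, exists p, res_aug p = x;
  res_exact0 : forall p, res_aug p = 0 <-> exists p', res_diff 0 p' = p;
  res_exactS : forall i p,
    res_diff i p = 0 <-> exists p', res_diff i.+1 p' = p
}.

(* H^1(Hom(P, C)) = 0 for every projective resolution P of X; the group does  *)
(* not depend on P, so this is Ext^1_R(X, C) = 0.                             *)
Definition Ext1_vanishes (R : comPzRingType) (X C : lmodType R) : Prop :=
  forall (P : proj_resolution X) (c : {linear res_obj P 1 -> C}),
    (forall p, c (res_diff P 1 p) = 0) ->
    exists b : {linear res_obj P 0 -> C}, forall p, c p = b (res_diff P 0 p).

Definition contraadjusted (R : comPzRingType) (C : lmodType R) : Prop :=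
  forall r : R, Ext1_vanishes (loc_elt_mod r) C.

(* Main.v *)
Require Import Defs.
From mathcomp Require Import all_boot all_algebra.
From HB Require Import structures.
From mathcomp Require Import ring boolp classical_sets functions topology.
Import GRing.Theory.
Local Open Scope ring_scope.
Set Implicit Arguments.
Unset Strict Implicit.
Unset Printing Implicit Defensive.

(* For an R-algebra B write H(B) = Hom_R(B, U). Every D_l prescribes a map    *)
(* H(B) -> V, h |-> D_l(h | S_l)(1), for each S_l-algebra B, and the          *)
(* compatibility of the D_jl makes it independent of l and of the structure   *)
(* map S_l -> B. So one has a natural additive family Psi_B : H(B) -> V on    *)
(* the algebras lying over some S_l, and D has to be its extension to         *)
(* H(R) = U.                                                                  *)
(*                                                                            *)
(* If a + b = 1 in A, the cokernel of A -> A_a (+) A_b is A_ab. When A_ab is  *)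
(* also of the form R[1/c], contraadjustedness of U gives                     *)
(* H(A) = H(A_a) + H(A_b), two elements of H(A_a) and H(A_b) cancelling in    *)
(* H(A) exactly when they come from one element of H(A_ab). Call B small if   *)
(* it lies over some S_l and is a principal localization of R. By induction   *)
(* on m, if s_1, ..., s_m generate the unit ideal of A and each A_{s_i} is    *)
(* small, then Psi extends uniquely to H(A): pass to a = sum_{i < m} t_i s_i  *)
(* and b = t_m s_m, where A_b and A_ab are small although A_a need not be.    *)
(* This applies to A = R and to A = S_l, because an open immersion becomes an *)
(* isomorphism after inverting suitable elements of R; the latter case shows  *)
(* D(g(1)) = D_l(g)(1), from which everything else about D follows.           *)

(** * Localization at an element *)

Section Localizations.

(** This says that [B] is [A[1/a]] by properties instead of by a construction, so that composites
    and algebras not built from fractions qualify too. *)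
Definition is_loc (A B : comPzRingType) (phi : {rmorphism A -> B}) (a : A) :=
  [/\ exists d, phi a * d = 1,
      forall y, exists n x, phi a ^+ n * y = phi x &
      forall x, phi x = 0 -> exists n, a ^+ n * x = 0].

Lemma expr_unitI (A : comPzRingType) (u d : A) n :
  u * d = 1 -> injective ( *%R (u ^+ n)).
Proof.
move=> ud x y /(congr1 ( *%R (d ^+ n))).
by rewrite !mulrA -exprMn [d * u]mulrC ud expr1n !mul1r.
Qed.

Lemma is_locI (A B : comPzRingType) (phi : {rmorphism A -> B}) (a : A) n :
  is_loc phi a -> injective ( *%R (phi a ^+ n)).
Proof. by case=> -[d ad] _ _; apply: expr_unitI ad. Qed.

Lemma is_loc_frac2 (A B C : comPzRingType) (phi : {rmorphism A -> B})
    (psi : {rmorphism A -> C}) (a b : A) (y : B) (z : C) :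
  is_loc phi a -> is_loc psi b ->
  exists n x w, phi a ^+ n * y = phi x /\ psi b ^+ n * z = psi w.
Proof.
case=> _ /(_ y)[m [x e]] _ [_ /(_ z)[n [w e']] _].
exists (m + n)%N, (a ^+ n * x), (b ^+ m * w); rewrite !rmorphM !rmorphXn -e -e'.
by rewrite !exprD; split; ring.
Qed.

Lemma is_loc_zero2 (A B : comPzRingType) (phi : {rmorphism A -> B})
    (a x y : A) :
  is_loc phi a -> phi x = phi y -> exists n, a ^+ n * x = a ^+ n * y.
Proof.
case=> _ _ loc0 e; have [|n e'] := loc0 (x - y).
  by rewrite rmorphB e subrr.
by exists n; apply/eqP; rewrite -subr_eq0 -mulrBr e'.
Qed.

Lemma is_loc_trans (A B C : comPzRingType) (phi : {rmorphism A -> B})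
    (psi : {rmorphism B -> C}) (a b : A) :
  is_loc phi a -> is_loc psi (phi b) -> is_loc (rcomp phi psi) (a * b).
Proof.
move=> [[d ad] locf loc0] [[d' bd'] locf' loc0']; split.
- exists (psi d * d'); rewrite rmorphM /= mulrACA -rmorphM ad rmorph1.
  by rewrite bd' mulr1.
- move=> y; have [m [x e]] := locf' y; have [n [w e']] := locf x.
  exists (m + n)%N, (a ^+ m * b ^+ n * w).
  have := congr1 psi e'; rewrite rmorphM rmorphXn /= -e => e2.
  rewrite !rmorphM !rmorphXn /= -e2 !exprMn !exprD; ring.
- move=> x /loc0'[m]; rewrite -rmorphXn -rmorphM => /loc0[n e].
  exists (m + n)%N; rewrite exprMn [a ^+ (_ + _)]exprD.
  have -> : b ^+ (m + n) = b ^+ n * b ^+ m by rewrite exprD mulrC.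
  transitivity (a ^+ m * b ^+ n * (a ^+ n * (b ^+ m * x))); first by ring.
  by rewrite e mulr0.
Qed.

Lemma is_loc_unitM (A B : comPzRingType) (phi : {rmorphism A -> B})
    (a u d : A) :
  u * d = 1 -> is_loc phi a -> is_loc phi (u * a).
Proof.
move=> ud [[c ac] locf loc0]; split.
- exists (phi d * c); rewrite rmorphM mulrACA -rmorphM ud ac rmorph1.
  by rewrite mulr1.
- move=> y; have [n [x e]] := locf y; exists n, (u ^+ n * x).
  by rewrite rmorphM rmorphM rmorphXn -e exprMn mulrA.
- move=> x /loc0[n e]; exists n.
  by rewrite exprMn -mulrA e mulr0.
Qed.

(** The converse of [is_loc_trans]: an algebra over [A[1/a]] that is [A[1/(ab)]] over [A] is the
    localization of [A[1/a]] at [b]. *)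
Lemma is_loc_factor (A B C : comPzRingType) (phi : {rmorphism A -> B})
    (psi : {rmorphism B -> C}) (a b : A) :
  is_loc phi a -> is_loc (rcomp phi psi) (a * b) -> is_loc psi (phi b).
Proof.
move=> la lab; have [[d ad] locf loc0] := la.
have [[d' bd'] locf' loc0'] := lab; split.
- exists (psi (phi a) * d'); rewrite -bd' /= !rmorphM; ring.
- move=> y; have [n [x e]] := locf' y; exists n, (d ^+ n * phi x).
  rewrite rmorphM -[psi (phi x)]e /= rmorphM rmorphM exprMn rmorphXn.
  rewrite mulrA mulrA -exprMn -rmorphM [d * _]mulrC ad rmorph1 expr1n.
  by rewrite mul1r.
- move=> y y0; have [n [x e]] := locf y.
  have : rcomp phi psi x = 0 by rewrite /= -e rmorphM y0 mulr0.
  move=> /loc0'[m e']; exists m; apply: (is_locI (n := (m + n)%N) la).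
  rewrite mulr0 exprD.
  transitivity (phi a ^+ m * phi b ^+ m * (phi a ^+ n * y)); first by ring.
  by rewrite e -!rmorphXn -!rmorphM -exprMn e' rmorph0.
Qed.

Lemma is_loc_elt (A : comPzRingType) (a : A) : is_loc (loc_elt_inj a) a.
Proof.
have pP n : a ^+ n \in powers a by apply/asboolP; exists n.
split.
- exists (Defs.frac (1, exist _ a (pP 1%N)) : loc_elt a); rewrite frac_mulE.
  by apply/fracP; exists 1; rewrite ?rpred1 //=; ring.
- move=> y; rewrite -(fracK y); case: (repr y) => x [s sP].
  have /asboolP[n sE] := sP; exists n, x.
  rewrite -rmorphXn frac_mulE; apply/fracP; exists 1; rewrite ?rpred1 //=.
  by rewrite sE; ring.
- by move=> x /fracP[u /asboolP[n ->]] /=; rewrite !mulr1 mulr0; exists n.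
Qed.

Lemma rmorph_exists (A B : comPzRingType) (g : A -> B) :
  {morph g : x y / x + y} -> {morph g : x y / x * y} -> g 1 = 1 ->
  exists G : {rmorphism A -> B}, G =1 g.
Proof.
move=> gD gM g1.
have g0 : g 0 = 0 by apply: (addrI (g 0)); rewrite -gD !addr0.
have gB : zmod_morphism g.
  move=> x y; apply: (addIr (g y)); rewrite -gD !subrK //.
pose gA := GRing.isZmodMorphism.Build A B g gB.
pose gMM := GRing.isMonoidMorphism.Build A B g (conj g1 gM).
pose G : {rmorphism A -> B} := HB.pack g gA gMM.
by exists G.
Qed.

Lemma is_loc_lift (A B C : comPzRingType) (phi : {rmorphism A -> B})
    (psi : {rmorphism A -> C}) (a : A) :
  is_loc phi a -> (exists d, psi a * d = 1) ->
  exists G : {rmorphism B -> C}, forall x, G (phi x) = psi x.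
Proof.
move=> la [d ad]; have [_ locf _] := la.
(* The graph of the sought homomorphism, defined on all fractions [x / a^n] at once; it is
   functional because [psi a] is a unit. *)
pose P y z := exists n x, phi a ^+ n * y = phi x /\ psi a ^+ n * z = psi x.
have Pfun y z z' : P y z -> P y z' -> z = z'.
  move=> [n [x [e1 e2]]] [m [w [e3 e4]]].
  have [|k e] := @is_loc_zero2 _ _ _ _ (a ^+ m * x) (a ^+ n * w) la.
    by rewrite !rmorphM !rmorphXn -e1 -e3; ring.
  apply: (expr_unitI (n := (k + (n + m))%N) ad).
  have := congr1 psi e; rewrite !rmorphM !rmorphXn -e2 -e4 !exprD => e'.
  transitivity (psi a ^+ k * (psi a ^+ m * (psi a ^+ n * z))); first by ring.
  by rewrite e'; ring.
have /boolp.choice[g gP] : forall y, exists z, P y z.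
  move=> y; have [n [x e]] := locf y.
  exists (d ^+ n * psi x), n, x; split=> //.
  by rewrite mulrA -exprMn ad expr1n mul1r.
have gphi x : g (phi x) = psi x.
  by apply: Pfun (gP _) _; exists 0%N, x; rewrite !expr0 !mul1r.
have [||| G GE] := @rmorph_exists _ _ g.
- move=> y y'; apply: Pfun (gP _) _.
  have [n [x [e1 e2]]] := gP y; have [m [w [e3 e4]]] := gP y'.
  exists (n + m)%N, (a ^+ m * x + a ^+ n * w).
  rewrite !rmorphD !rmorphM !rmorphXn -e1 -e2 -e3 -e4 !exprD.
  by split; ring.
- move=> y y'; apply: Pfun (gP _) _.
  have [n [x [e1 e2]]] := gP y; have [m [w [e3 e4]]] := gP y'.
  exists (n + m)%N, (x * w).
  by rewrite !rmorphM -e1 -e2 -e3 -e4 !exprD; split; ring.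
- by rewrite -(rmorph1 phi) gphi rmorph1.
by exists G => x; rewrite GE.
Qed.

Lemma comax_mull (A : comPzRingType) (x x' y : A) :
  (exists p q, p * x + q * y = 1) -> (exists p q, p * x' + q * y = 1) ->
  exists p q, p * (x * x') + q * y = 1.
Proof.
move=> [p [q e]] [p' [q' e']].
exists (p * p'), (q + q' * (p * x)).
transitivity ((p * x) * (p' * x' + q' * y) + q * y); first by ring.
by rewrite e' mulr1.
Qed.

Lemma comax_exp (A : comPzRingType) (a b : A) n :
  a + b = 1 -> exists p q, p * a ^+ n + q * b ^+ n = 1.
Proof.
move=> ab1.
have H k : exists p q, p * a ^+ k + q * b = 1.
  elim: k => [|k IHk]; first by exists 1, 0; rewrite mul0r addr0 mul1r expr0.
  by rewrite exprS; apply: comax_mull => //; exists 1, 1; rewrite !mul1r.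
have Hb k : exists p q, p * b ^+ k + q * a ^+ n = 1.
  elim: k => [|k IHk].
    by exists 1, 0; rewrite mul0r addr0 mul1r expr0.
  rewrite exprS; apply: comax_mull => //.
  by have [p [q e]] := H n; exists q, p; rewrite addrC.
by have [p [q e]] := Hb n; exists q, p; rewrite addrC.
Qed.

End Localizations.

(** * The telescope resolution of a principal localization *)

Section FinitelySupportedSequences.
Variable R : comPzRingType.

Definition finsupp : {pred nat -> R^o} :=
  fun x => `[< exists N, forall k, (N <= k)%N -> x k = 0 >].

Let finsupp_closed : submod_closed finsupp.
Proof.
split=> [|a x y /asboolP[N xN] /asboolP[M yM]]; apply/asboolP.
  by exists 0%N.
exists (N + M)%N => k le_k.
have leN : (N <= k)%N by apply: leq_trans (leq_addr _ _) le_k.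
have leM : (M <= k)%N by apply: leq_trans (leq_addl _ _) le_k.
transitivity (a * x k + y k); first by [].
by rewrite xN // yM // mulr0 addr0.
Qed.

HB.instance Definition _ :=
  GRing.isSubmodClosed.Build R (nat -> R^o) finsupp finsupp_closed.

(** The free module with basis [finseq_delta k], to be thought of as [R[X]] with basis [X^k]. *)
Record finseq := FinSeq {
  finseq_val :> nat -> R^o;
  _ : finseq_val \in finsupp
}.
HB.instance Definition _ := [isSub for finseq_val].
HB.instance Definition _ := [Choice of finseq by <:].
HB.instance Definition _ := [SubChoice_isSubLmodule of finseq by <:].

Lemma finseqP (x : finseq) : exists N, forall k, (N <= k)%N -> x k = 0.
Proof. by case: x => x /= /asboolP. Qed.

Lemma finseq_eq (x y : finseq) : (forall k, x k = y k) -> x = y.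
Proof. by move=> /funext e; apply: val_inj. Qed.

Lemma finseqE a (x y : finseq) k : (a *: x + y) k = a * x k + y k.
Proof. by []. Qed.

Lemma finsuppP (x : nat -> R^o) N :
  (forall k, (N <= k)%N -> x k = 0) -> x \in finsupp.
Proof. by move=> xN; apply/asboolP; exists N. Qed.

Let delta_finsupp (n : nat) : (fun k => (k == n)%:R) \in finsupp.
Proof. by apply: (@finsuppP _ n.+1) => k lt_nk; rewrite gtn_eqF. Qed.

Definition finseq_delta (n : nat) : finseq := FinSeq (delta_finsupp n).

Section LinearExtension.
Variables (M : lmodType R) (m : nat -> M).

(** The sum stops at a chosen bound of the support; [finseq_linE] shows that any other bound gives
    the same value. *)
Definition finseq_lin (x : finseq) : M :=
  \sum_(0 <= k < projT1 (cid (finseqP x))) x k *: m k.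

Lemma finseq_linE (x : finseq) N : (forall k, (N <= k)%N -> x k = 0) ->
  finseq_lin x = \sum_(0 <= k < N) x k *: m k.
Proof.
rewrite /finseq_lin; case: cid => N' /= xN' xN.
suff widen n n' : (n <= n')%N -> (forall k, (n <= k)%N -> x k = 0) ->
    \sum_(0 <= k < n') x k *: m k = \sum_(0 <= k < n) x k *: m k.
  by case/orP: (leq_total N N') => le; [|symmetry]; apply: widen.
move=> le_n xn; rewrite (big_cat_nat (n := n)) //= [X in _ + X]big_nat_cond.
rewrite [X in _ + X]big1 ?addr0 // => k /andP[/andP[le_k _] _].
by rewrite xn ?scale0r.
Qed.

Let finseq_lin_linear : linear finseq_lin.
Proof.
move=> a x y; have [N xN] := finseqP x; have [N' yN'] := finseqP y.
have xP k : (N + N' <= k)%N -> x k = 0.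
  by move=> le_k; apply/xN/(leq_trans _ le_k)/leq_addr.
have yP k : (N + N' <= k)%N -> y k = 0.
  by move=> le_k; apply/yN'/(leq_trans _ le_k)/leq_addl.
rewrite (finseq_linE xP) (finseq_linE yP).
rewrite (@finseq_linE _ (N + N')) => [|k le_k].
  rewrite scaler_sumr -big_split /=; apply: eq_bigr => k _.
  by rewrite [_ k]finseqE scalerDl scalerA.
by rewrite [LHS]finseqE xP // yP // mulr0 addr0.
Qed.

HB.instance Definition _ :=
  GRing.isLinear.Build R finseq M *:%R finseq_lin finseq_lin_linear.

Lemma finseq_lin_delta n : finseq_lin (finseq_delta n) = m n.
Proof.
rewrite (@finseq_linE _ n.+1) => [|k lt_nk]; last by rewrite /= gtn_eqF.
rewrite big_nat_recr //= eqxx scale1r big_nat_cond big1 ?add0r //.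
by move=> k /andP[/andP[_ lt_kn] _]; rewrite ltn_eqF // scale0r.
Qed.

End LinearExtension.

Lemma finseq_decomp (x : finseq) N : (forall k, (N <= k)%N -> x k = 0) ->
  x = \sum_(0 <= k < N) x k *: finseq_delta k.
Proof.
move=> xN; rewrite -(finseq_linE finseq_delta xN); apply: finseq_eq => k.
have [N' le_kN' xN'] :
    exists2 N', (k < N')%N & forall j, (N' <= j)%N -> x j = 0.
  exists (N + k.+1)%N; first exact: leq_addl.
  by move=> j le_j; apply/xN/(leq_trans _ le_j)/leq_addr.
rewrite (finseq_linE _ xN').
have valE n (F : nat -> finseq) :
    (\sum_(0 <= i < n) F i) k = \sum_(0 <= i < n) (F i k : R).
  elim: n => [|n IHn]; first by rewrite !big_geq.
  by rewrite !big_nat_recr //= -IHn.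
have scaleE j : (x j *: finseq_delta j) k = x j * (k == j)%:R.
  by have := finseqE (x j) (finseq_delta j) 0 k; rewrite addr0 [RHS]addr0.
rewrite valE (bigD1_seq k) ?iota_uniq ?mem_index_iota // big1.
  by rewrite scaleE eqxx mulr1 /= addr0.
by move=> j ne_jk; rewrite scaleE eq_sym (negbTE ne_jk) mulr0.
Qed.

Lemma finseq_linear_ext (M : lmodType R) (g h : {linear finseq -> M}) :
  (forall k, g (finseq_delta k) = h (finseq_delta k)) -> g =1 h.
Proof.
move=> gh x; have [N xN] := finseqP x; rewrite (finseq_decomp xN).
by rewrite !linear_sum; apply: eq_bigr => k _; rewrite !linearZ /= gh.
Qed.

Lemma finseq_projective : projective finseq.
Proof.
move=> X Y g h g_surj.
have /boolp.choice[m mP] : forall k, exists x, g x = h (finseq_delta k).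
  by move=> k; apply: g_surj.
exists (finseq_lin m) => x.
apply: (@finseq_linear_ext _ (g \o finseq_lin m) h) => k /=.
by rewrite finseq_lin_delta.
Qed.

End FinitelySupportedSequences.

Section TelescopeResolution.
Variables (R : comPzRingType) (r : R).

(** Multiplication by [1 - rX] on [R[X]]; its cokernel is [R[1/r]]. *)
Definition telescope_fun (x : nat -> R^o) : nat -> R^o :=
  fun k => if k is k'.+1 then x k - r * x k' else x k.

Let telescope_finsupp (x : finseq R) : telescope_fun x \in @finsupp R.
Proof.
have [N xN] := finseqP x; apply: (@finsuppP R _ N.+1) => -[//|k] le_k /=.
by rewrite !xN ?mulr0 ?subr0 // ltnW.
Qed.

Definition telescope (x : finseq R) : finseq R := FinSeq (telescope_finsupp x).

Let telescope_linear : linear telescope.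
Proof.
move=> a x y; apply: finseq_eq => -[//|k].
transitivity (a * x k.+1 + y k.+1 - r * (a * x k + y k)); first by [].
transitivity (a * (x k.+1 - r * x k) + (y k.+1 - r * y k)); last by [].
by ring.
Qed.

HB.instance Definition _ :=
  GRing.isLinear.Build R (finseq R) (finseq R) *:%R telescope telescope_linear.

Lemma telescope_delta k :
  telescope (finseq_delta R k) = finseq_delta R k - r *: finseq_delta R k.+1.
Proof.
apply: finseq_eq => j; rewrite addrC -scaleNr finseqE /=.
case: j => [|j]; first by rewrite mulr0 add0r.
by rewrite /telescope_fun /= eqSS addrC mulNr.
Qed.

Lemma telescope_inj x : telescope x = 0 -> x = 0.
Proof.
move=> x0; have xE k : telescope x k = 0 by rewrite x0.
apply: finseq_eq; elim=> [|k IHk]; first exact: (xE 0%N).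
transitivity (x k.+1 - r * x k); last exact: (xE k.+1).
by rewrite IHk [X in _ = _ - X]mulr0 subr0.
Qed.

(** Divide [x] by [1 - rX] as a power series. The coefficients of the quotient [y] beyond [N] are
    [r^j] times one fixed sum, so they vanish from [N + n] on, and [y] is a polynomial. *)
Lemma telescope_image (x : finseq R) n N :
  (forall k, (N <= k)%N -> x k = 0) ->
  r ^+ n * \sum_(0 <= k < N) r ^+ (N - k) * x k = 0 ->
  exists y, telescope y = x.
Proof.
move=> xN rx0; pose y k : R^o := \sum_(0 <= i < k.+1) r ^+ (k - i) * x i.
have yS k : y k.+1 = x k.+1 + r * y k.
  rewrite /y big_nat_recr //= subnn expr0 mul1r addrC; congr (_ + _).
  rewrite mulr_sumr; apply: eq_big_nat => i /andP[_ lt_ik].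
  by rewrite subSn // exprS mulrA.
have yD j : y (N + j)%N = r ^+ j * \sum_(0 <= k < N) r ^+ (N - k) * x k.
  elim: j => [|j IHj].
    rewrite addn0 expr0 mul1r /y big_nat_recr //= xN // mulr0 addr0 //.
  by rewrite addnS yS IHj xN ?add0r ?exprS ?mulrA // ltnW // ltnS leq_addr.
have y_fin : y \in @finsupp R.
  apply: (@finsuppP _ _ (N + n)%N) => k le_k.
  have [j ->] : exists j, k = (N + (n + j))%N.
    by exists (k - (N + n))%N; rewrite addnA subnKC.
  by rewrite yD addnC exprD -mulrA rx0 mulr0.
exists (FinSeq y_fin); apply: finseq_eq => -[|k]; rewrite /= ?yS ?addrK //.
by rewrite /y big_nat1 expr0 mul1r.
Qed.

End TelescopeResolution.

Section LocalizationResolution.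
Variables (R : comPzRingType) (r : R).

Let inv_r : loc_elt r := let: And3 e _ _ := is_loc_elt r in projT1 (cid e).

Let inv_rP : loc_elt_inj r r * inv_r = 1.
Proof. by rewrite /inv_r; case: is_loc_elt => e _ _; case: cid. Qed.

Let aug : {linear finseq R -> loc_elt_mod r} :=
  finseq_lin (fun k => inv_r ^+ k : loc_elt_mod r).

(** Clearing denominators in [sum_k x_k r^-k] leaves the image of the very sum that
    [telescope_image] wants killed by a power of [r]. *)
Let augE (x : finseq R) N : (forall k, (N <= k)%N -> x k = 0) ->
  loc_elt_inj r r ^+ N * (aug x : loc_elt r)
  = loc_elt_inj r (\sum_(0 <= k < N) r ^+ (N - k) * x k).
Proof.
move=> xN; rewrite [aug x](finseq_linE _ xN) mulr_sumr rmorph_sum.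
apply: eq_big_nat => k /andP[_ lt_kN].
transitivity (loc_elt_inj r r ^+ N * (loc_elt_inj r (x k) * inv_r ^+ k)).
  by [].
rewrite rmorphM rmorphXn -{1}(subnK (ltnW lt_kN)) exprD.
transitivity (loc_elt_inj r r ^+ (N - k) * loc_elt_inj r (x k)
   * (loc_elt_inj r r * inv_r) ^+ k); first by rewrite exprMn; ring.
by rewrite inv_rP expr1n mulr1.
Qed.

Let aug_surj (y : loc_elt_mod r) : exists x, aug x = y.
Proof.
have [_ /(_ y)[n [a e]] _] := is_loc_elt r.
exists (a *: finseq_delta R n); rewrite linearZ /= finseq_lin_delta.
transitivity (loc_elt_inj r a * inv_r ^+ n); first by [].
by rewrite -e mulrAC -exprMn inv_rP expr1n mul1r.
Qed.

Let aug_exact (x : finseq R) : aug x = 0 <-> exists y, telescope r y = x.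
Proof.
split=> [x0|[y <-]].
  have [N xN] := finseqP x; have := augE xN; rewrite x0 mulr0 => /esym.
  have [_ _ loc0] := is_loc_elt r; move=> /loc0[n]; exact: telescope_image.
apply: (@finseq_linear_ext _ _ (aug \o telescope r) \0) => k /=.
rewrite telescope_delta linearB linearZ /= !finseq_lin_delta.
transitivity (inv_r ^+ k - loc_elt_inj r r * inv_r ^+ k.+1); first by [].
by rewrite exprS mulrA inv_rP mul1r subrr.
Qed.

(** [R[1/r]] has the free resolution [0 -> R[X] -> R[X] -> R[1/r] -> 0], continued by zero
    modules. *)
Let obj (i : nat) : lmodType R := if i is _.+2 then 'rV[R]_0 else finseq R.

Let diff (i : nat) : {linear obj i.+1 -> obj i} :=
  match i with 0 => telescope r | _ => \0 end.

Let obj_projective i : projective (obj i).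
Proof.
case: i => [|[|i]]; [exact: finseq_projective | exact: finseq_projective |].
move=> X Y g h _; exists \0 => p; rewrite linear0 (_ : p = 0) ?linear0 //.
by apply/rowP => -[].
Qed.

Let diff_exact i (p : obj i.+1) :
  diff i p = 0 <-> exists p', diff i.+1 p' = p.
Proof.
case: i p => [|i] p /=.
  split=> [/telescope_inj->|[p' <-]]; last exact: linear0 (telescope r).
  by exists 0.
by split=> // _; exists 0; apply/rowP => -[].
Qed.

Let resolution : proj_resolution (loc_elt_mod r) :=
  ProjResolution obj_projective aug_surj aug_exact diff_exact.

(** As the resolution stops in degree 1, every linear map on its degree 1 term is a cocycle, hence a
    coboundary. Writing the one that sends the [k]-th basis vector to [- u k] as [b] composed with
    [telescope r] gives [v k] as the value of [b] at that vector. *)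
Lemma contraadjusted_telescope (U : lmodType R) (u : nat -> U) :
  contraadjusted U -> exists v : nat -> U, forall k, r *: v k.+1 = v k + u k.
Proof.
move=> /(_ r resolution (finseq_lin (fun k => - u k)))[p|b bP].
  exact: (linear0 (finseq_lin _)).
exists (fun k => b (finseq_delta R k)) => k.
have := bP (finseq_delta R k); rewrite /= finseq_lin_delta telescope_delta.
rewrite linearB linearZ /= => /eqP; rewrite eqr_oppLR opprB => /eqP->.
by rewrite addrC subrK.
Qed.

End LocalizationResolution.

(** * Linear maps into a contraadjusted module *)

(** The obstruction to extending a linear map from the kernel of [p] to [F] lies in [Ext^1_R(C, U)],
    and [C] is [R[1/c]]. Concretely, lifts [f n] of [1/c^n] satisfy [c f_(n+1) = f_n] only modulo
    the kernel, and the telescope equations provide values [w n] absorbing this defect. *)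
Lemma extend_contraadjusted (R C : comPzRingType) (psi : {rmorphism R -> C})
    (c : R) (F U : lmodType R) (p : F -> C) (k : F -> U) :
  is_loc psi c -> contraadjusted U ->
  (forall r x y, p (r *: x + y) = psi r * p x + p y) ->
  (forall z, exists x, p x = z) ->
  (forall r x y, p x = 0 -> p y = 0 -> k (r *: x + y) = r *: k x + k y) ->
  exists G : F -> U, (forall r x y, G (r *: x + y) = r *: G x + G y) /\
    forall x, p x = 0 -> G x = k x.
Proof.
move=> [[d cd] locf loc0] U_contra pP p_surj kP.
have p0 : p 0 = 0.
  by have := pP (-1) 0 0; rewrite scaler0 addr0 rmorphN1 mulN1r addNr.
have k0 : k 0 = 0.
  by have := kP (-1) 0 0 p0 p0; rewrite scaler0 addr0 scaleN1r addNr.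
have pZ r x : p (r *: x) = psi r * p x by rewrite -[r *: x]addr0 pP p0 addr0.
have pB x y : p (x - y) = p x - p y.
  by rewrite addrC -scaleN1r pP rmorphN1 mulN1r addrC.
have kZ r x : p x = 0 -> k (r *: x) = r *: k x.
  by move=> px; rewrite -[r *: x]addr0 kP // k0 addr0.
have kB x y : p x = 0 -> p y = 0 -> k (x - y) = k x - k y.
  by move=> px py; rewrite addrC -scaleN1r kP // scaleN1r addrC.
have /boolp.choice[f fP] : forall n, exists x, p x = d ^+ n.
  by move=> n; apply: p_surj.
have step0 n : p (c *: f n.+1 - f n) = 0.
  by rewrite pB pZ !fP exprS mulrA cd mul1r subrr.
have [w wP] := contraadjusted_telescope c
  (fun n => k (c *: f n.+1 - f n)) U_contra.
(* [f n] lifts [1/c^n], and [w n] is the value prescribed for it. *)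
pose graph x y := exists n a,
  p x = psi a * d ^+ n /\ y = k (x - a *: f n) + a *: w n.
(* Passing from the fraction [a / c^n] to [c^m a / c^(n+m)] does not change the proposed value; the
   recursion for [w] is exactly what this needs. *)
have shift n a x y m :
    p x = psi a * d ^+ n -> y = k (x - a *: f n) + a *: w n ->
    p x = psi (c ^+ m * a) * d ^+ (n + m) /\
    y = k (x - (c ^+ m * a) *: f (n + m)%N) + (c ^+ m * a) *: w (n + m)%N.
  move=> px ->; elim: m => [|m [IHp IHy]]; first by rewrite expr0 mul1r addn0.
  split.
    transitivity (psi c * d * (psi (c ^+ m * a) * d ^+ (n + m))).
      by rewrite cd mul1r.
    rewrite addnS [d ^+ _.+1]exprS [c ^+ m.+1]exprS -[c * _ * a]mulrA.
    by rewrite [psi (c * _)]rmorphM; ring.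
  rewrite IHy addnS exprS -mulrA.
  move: (c ^+ m * a) (n + m)%N IHp {IHy} => b N IHp.
  have xb : p (x - b *: f N) = 0 by rewrite pB pZ fP IHp subrr.
  rewrite [c * b]mulrC -!scalerA wP scalerDr.
  have -> : x - b *: (c *: f N.+1)
      = (x - b *: f N) - b *: (c *: f N.+1 - f N).
    by rewrite scalerBr opprB addrA addrNK.
  have bf : p (b *: (c *: f N.+1 - f N)) = 0 by rewrite pZ step0 mulr0.
  by rewrite (kB _ _ xb bf) (kZ _ _ (step0 N)) addrACA addNr addr0.
have graph0 y : graph 0 y -> y = 0.
  move=> [n [a [pa ->]]]; rewrite p0 in pa.
  have /loc0[m ma] : psi a = 0.
    by apply: (expr_unitI (n := n) (_ : d * psi c = 1));
      rewrite ?mulr0 mulrC // cd.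
  have [_ ->] := shift _ _ _ _ m (etrans p0 pa) (erefl _).
  by rewrite ma !scale0r subr0 k0 addr0.
have graphP r x y x' y' : graph x y -> graph x' y' ->
    graph (r *: x + x') (r *: y + y').
  move=> [n [a [px py]]] [n' [a' [px' py']]].
  have := shift _ _ _ _ n' px py; have := shift _ _ _ _ n px' py'.
  rewrite [(n' + n)%N]addnC {px py px' py'}.
  move: (c ^+ n' * a) (c ^+ n * a') (n + n')%N => b b' N.
  move=> [px' ->] [px ->]; exists N, (r * b + b'); split.
    by rewrite pP px px' rmorphD rmorphM mulrDl mulrA.
  rewrite scalerDl -scalerA opprD addrACA -scalerBr kP.
  - by rewrite scalerDr addrACA scalerDl scalerA.
  - by rewrite pB pZ fP px subrr.
  - by rewrite pB pZ fP px' subrr.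
have graph_fun x y y' : graph x y -> graph x y' -> y = y'.
  move=> xy xy'; have := graphP (-1) _ _ _ _ xy xy'.
  rewrite !scaleN1r addNr => /graph0 /eqP.
  by rewrite addrC subr_eq0 => /eqP.
have /boolp.choice[G GP] : forall x, exists y, graph x y.
  move=> x; have [n [a e]] := locf (p x).
  exists (k (x - a *: f n) + a *: w n), n, a; split=> //.
  by rewrite -e mulrAC -exprMn cd expr1n mul1r.
exists G; split=> [r x y|x px].
  by apply: graph_fun (GP _) _; apply: graphP.
apply: graph_fun (GP _) _; exists 0%N, 0.
by rewrite px rmorph0 mul0r !scale0r subr0 addr0.
Qed.

Section LinearMaps.
Variables (R A : comPzRingType) (phi : {rmorphism R -> A}) (U : lmodType R).

(** Elements of [Hom_R(A, U)] as bare functions, so that restriction along a homomorphism is plain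
    composition. *)
Definition lin (g : A -> U) := forall r x y, g (phi r * x + y) = r *: g x + g y.

Lemma linD g x y : lin g -> g (x + y) = g x + g y.
Proof. by move=> /(_ 1 x y); rewrite rmorph1 mul1r scale1r. Qed.

Lemma lin_0 g : lin g -> g 0 = 0.
Proof. by move=> gP; apply: (addrI (g 0)); rewrite -(linD _ _ gP) !addr0. Qed.

Lemma lin_const0 : lin (fun _ => 0).
Proof. by move=> r x y; rewrite scaler0 addr0. Qed.

Lemma lin_add g h : lin g -> lin h -> lin (fun x => g x + h x).
Proof. by move=> gP hP r x y; rewrite gP hP scalerDr addrACA. Qed.

Lemma lin_opp g : lin g -> lin (fun x => - g x).
Proof. by move=> gP r x y; rewrite gP opprD scalerN. Qed.

Lemma lin_comp (B : comPzRingType) (psi : {rmorphism R -> B})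
    (alpha : {rmorphism A -> B}) (h : B -> U) :
  (forall r, alpha (phi r) = psi r) ->
  (forall r x y, h (psi r * x + y) = r *: h x + h y) ->
  lin (fun x => h (alpha x)).
Proof. by move=> e hP r x y; rewrite rmorphD rmorphM e hP. Qed.

End LinearMaps.

Section TwoElementCover.

(** The cover of [Spec A] by [D(a)] and [D(b)], with [C] the ring [A[1/(ab)]] of their
    intersection. *)
Definition cover_square (A Aa Ab C : comPzRingType) (a b : A)
    (alpha : {rmorphism A -> Aa}) (beta : {rmorphism A -> Ab})
    (alpha' : {rmorphism Aa -> C}) (beta' : {rmorphism Ab -> C}) :=
  [/\ a + b = 1, is_loc alpha a, is_loc beta b,
      (forall x, alpha' (alpha x) = beta' (beta x)) &
      is_loc (rcomp alpha alpha') (a * b)].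

Lemma cover_square_exists (A Aa Ab C : comPzRingType) (a b : A)
    (alpha : {rmorphism A -> Aa}) (beta : {rmorphism A -> Ab})
    (beta' : {rmorphism Ab -> C}) :
  a + b = 1 -> is_loc alpha a -> is_loc beta b -> is_loc beta' (beta a) ->
  exists alpha' : {rmorphism Aa -> C}, cover_square a b alpha beta alpha' beta'.
Proof.
move=> ab la lb lba; have lab := is_loc_trans lb lba.
have [G GP] := is_loc_lift (psi := rcomp beta beta') la
  (let: And3 e _ _ := lba in e).
exists G; split=> //; have [e locf loc0] := lab; rewrite mulrC; split.
- by have [d ed] := e; exists d; rewrite -ed /= GP.
- by move=> y; have [n [x exy]] := locf y; exists n, x; rewrite /= !GP.
- by move=> x /=; rewrite GP; apply: loc0.
Qed.

Variables (A Aa Ab C : comPzRingType) (a b : A).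
Variables (alpha : {rmorphism A -> Aa}) (beta : {rmorphism A -> Ab}).
Variables (alpha' : {rmorphism Aa -> C}) (beta' : {rmorphism Ab -> C}).
Hypothesis sq : cover_square a b alpha beta alpha' beta'.

(** This lemma and the next two give the exactness of [0 -> A -> A_a (+) A_b -> A_ab -> 0]. All
    three rest on a relation [p a^N + q b^N = 1]. *)
Lemma cover_square_inj x : alpha x = 0 -> beta x = 0 -> x = 0.
Proof.
case: sq => ab [_ _ loca] [_ _ locb] _ _ /loca[n ax] /locb[m bx].
have [p [q e]] := comax_exp (n + m) ab.
transitivity ((p * a ^+ (n + m) + q * b ^+ (n + m)) * x).
  by rewrite e mul1r.
transitivity (p * a ^+ m * (a ^+ n * x) + q * b ^+ n * (b ^+ m * x)).
  by rewrite !exprD; ring.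
by rewrite ax bx !mulr0 addr0.
Qed.

Lemma cover_square_exact x y : alpha' x = beta' y ->
  exists z, alpha z = x /\ beta z = y.
Proof.
case: sq => ab la lb comm lab xy.
have [n [x0 [y0 [ex ey]]]] := is_loc_frac2 x y la lb.
have [|m em] := is_loc_zero2 (x := b ^+ n * x0) (y := a ^+ n * y0) lab.
  rewrite /= rmorphM rmorphM -ex [in RHS]rmorphM [in RHS]rmorphM.
  rewrite [in RHS](comm y0) -ey !rmorphM !rmorphXn -xy !comm.
  by ring.
have [p [q e]] := comax_exp (m + n) ab.
(* With denominators [a^(m+n)] and [b^(m+n)], the numerators of [x] and [y] are [a^m x0] and
   [b^m y0]. They agree crosswise by [em'], so the partition of unity glues them to [z]. *)
pose z := p * (a ^+ m * x0) + q * (b ^+ m * y0).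
have em' : b ^+ (m + n) * (a ^+ m * x0) = a ^+ (m + n) * (b ^+ m * y0).
  transitivity ((a * b) ^+ m * (b ^+ n * x0)).
    by rewrite exprD exprMn; ring.
  by rewrite em exprD exprMn; ring.
have az : a ^+ (m + n) * z = a ^+ m * x0.
  transitivity (p * (a ^+ (m + n) * (a ^+ m * x0))
     + q * (a ^+ (m + n) * (b ^+ m * y0))); first by rewrite /z; ring.
  by rewrite -em' !mulrA -mulrDl -mulrDl e mul1r.
have bz : b ^+ (m + n) * z = b ^+ m * y0.
  transitivity (p * (b ^+ (m + n) * (a ^+ m * x0))
     + q * (b ^+ (m + n) * (b ^+ m * y0))); first by rewrite /z; ring.
  by rewrite em' !mulrA -mulrDl -mulrDl e mul1r.
exists z; split.
  apply: (is_locI (n := (m + n)%N) la).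
  by rewrite -rmorphXn -rmorphM az rmorphM -ex !rmorphXn exprD mulrA.
apply: (is_locI (n := (m + n)%N) lb).
by rewrite -rmorphXn -rmorphM bz rmorphM -ey !rmorphXn exprD mulrA.
Qed.

Lemma cover_square_onto w : exists x y, alpha' x + beta' y = w.
Proof.
case: sq => ab [[da ea] _ _] [[db eb] _ _] comm lab.
have [_ /(_ w)[n [z ez]] _] := lab.
have [p [q e]] := comax_exp n ab.
(* If [w = z / (ab)^n], then [z = z (p a^n + q b^n)] gives [w = zq / a^n + zp / b^n]. *)
exists (alpha (z * q) * da ^+ n), (beta (z * p) * db ^+ n).
apply: (is_locI (n := n) lab); rewrite ez.
have eA : alpha' (alpha a) ^+ n * alpha' (da ^+ n) = 1.
  by rewrite -rmorphXn -rmorphM -exprMn ea expr1n rmorph1.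
have eB : alpha' (alpha b) ^+ n * beta' (db ^+ n) = 1.
  by rewrite comm -rmorphXn -rmorphM -exprMn eb expr1n rmorph1.
have e1 : alpha' (alpha p) * alpha' (alpha a) ^+ n
    + alpha' (alpha q) * alpha' (alpha b) ^+ n = 1.
  by rewrite -!rmorphXn -!rmorphM -!rmorphD e !rmorph1.
rewrite [alpha' (_ * _)]rmorphM [beta' (_ * _)]rmorphM -comm.
rewrite /= !rmorphM exprMn.
transitivity (alpha' (alpha z) * (alpha' (alpha q) * alpha' (alpha b) ^+ n
    * (alpha' (alpha a) ^+ n * alpha' (da ^+ n))
  + alpha' (alpha p) * alpha' (alpha a) ^+ n
    * (alpha' (alpha b) ^+ n * beta' (db ^+ n)))); first by ring.
by rewrite eA eB !mulr1 [X in _ * X]addrC e1 mulr1.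
Qed.

Variables (R : comPzRingType) (phi : {rmorphism R -> A}) (U : lmodType R).
Local Notation gamma := (rcomp phi (rcomp alpha alpha')).

(** Here [A] is the kernel of the surjection [p] from [A_a (+) A_b] onto [A_ab]; as [A_ab] is
    [R[1/c]], the map [g] extends from this kernel to the sum. *)
Lemma lin_split c g :
  is_loc gamma c -> contraadjusted U -> lin phi g ->
  exists ga gb, [/\ lin (U := U) (rcomp phi alpha) ga, lin (rcomp phi beta) gb &
    forall x, g x = ga (alpha x) + gb (beta x)].
Proof.
move=> lc U_contra gP; case: (sq) => _ _ _ comm _.
pose F : lmodType R :=
  (restr (rcomp phi alpha) Aa^o * restr (rcomp phi beta) Ab^o)%type.
pose p (f : F) : C := alpha' f.1 - beta' f.2.
have pP r (x y : F) : p (r *: x + y) = gamma r * p x + p y.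
  rewrite /p; transitivity (alpha' (alpha (phi r) * x.1 + y.1)
    - beta' (beta (phi r) * x.2 + y.2)); first by [].
  by rewrite !rmorphD !rmorphM -comm /=; ring.
(* [j] inverts the embedding of [A] onto the kernel of [p]. Off the kernel its value is arbitrary,
   since the extension looks at [g \o j] on the kernel alone. *)
have /boolp.choice[j jP] : forall f : F, exists z, p f = 0 ->
    alpha z = f.1 /\ beta z = f.2.
  move=> f; have [pf|npf] := EM (p f = 0); last by exists 0.
  have [|z zP] := @cover_square_exact f.1 f.2; last by exists z.
  by apply/eqP; rewrite -subr_eq0; apply/eqP.
have j_unique f z : p f = 0 -> alpha z = f.1 -> beta z = f.2 -> j f = z.
  move=> /jP[e1 e2] e3 e4; apply/eqP; rewrite -subr_eq0; apply/eqP.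
  by apply: cover_square_inj; rewrite rmorphB ?e1 ?e2 ?e3 ?e4 subrr.
have [|||G [GP Gg]] := extend_contraadjusted (p := p) (k := g \o j) lc U_contra.
- exact: pP.
- move=> w; have [x [y e]] := cover_square_onto w.
  by exists (x, - y); rewrite /p /= rmorphN opprK.
- move=> r x y px py /=; rewrite -gP; congr g.
  have [e1 e2] := jP _ px; have [e3 e4] := jP _ py.
  apply: j_unique; first by rewrite pP px py mulr0 addr0.
    by rewrite rmorphD rmorphM e1 e3.
  by rewrite rmorphD rmorphM e2 e4.
have G0 : G 0 = 0 by have := GP (-1) 0 0; rewrite scaler0 addr0 scaleN1r addNr.
exists (fun x => G (x, 0)), (fun y => G (0, y)); split.
- move=> r x y; rewrite -GP; congr G; rewrite [RHS]surjective_pairing /=.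
  by congr (_, _); rewrite scaler0 addr0.
- move=> r x y; rewrite -GP; congr G; rewrite [RHS]surjective_pairing /=.
  by congr (_, _); rewrite scaler0 addr0.
move=> x; have := GP 1 (alpha x, 0) (0, beta x); rewrite !scale1r => <-.
have -> : (alpha x, 0) + (0, beta x) = (alpha x, beta x) :> F.
  by rewrite [LHS]surjective_pairing /= addr0 add0r.
have px : p (alpha x, beta x) = 0 by rewrite /p /= comm subrr.
by rewrite Gg //=; congr g; apply/esym/j_unique.
Qed.

(** A pair that cancels on [A] descends to the cokernel [A_ab]: the element [alpha' x + beta' y]
    receives the value [ga x - gb y]. *)
Lemma lin_glue ga gb :
  lin (U := U) (rcomp phi alpha) ga -> lin (rcomp phi beta) gb ->
  (forall x, ga (alpha x) + gb (beta x) = 0) ->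
  exists h, [/\ lin (U := U) gamma h, (forall x, ga x = h (alpha' x)) &
    forall y, gb y = - h (beta' y)].
Proof.
move=> gaP gbP gab0; case: (sq) => _ _ _ comm _.
pose graph w u := exists x y, alpha' x + beta' y = w /\ u = ga x - gb y.
have graphP r w u w' u' : graph w u -> graph w' u' ->
    graph (gamma r * w + w') (r *: u + u').
  move=> [x [y [<- ->]]] [x' [y' [<- ->]]].
  exists (rcomp phi alpha r * x + x'), (rcomp phi beta r * y + y'); split.
    by rewrite !rmorphD !rmorphM /= -comm; ring.
  by rewrite gaP gbP scalerBr opprD addrACA.
have graph0 u : graph 0 u -> u = 0.
  move=> [x [y [exy ->]]].
  have [|z [<- ez]] := @cover_square_exact x (- y).
    by rewrite rmorphN; apply/eqP; rewrite -addr_eq0; apply/eqP.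
  rewrite -(gab0 z) ez; congr (_ + _); apply/esym.
  apply/eqP; rewrite -addr_eq0 -(linD _ _ gbP) addNr.
  by rewrite (lin_0 gbP).
have graph_fun w u u' : graph w u -> graph w u' -> u = u'.
  move=> wu wu'; have := graphP (-1) _ _ _ _ wu wu'.
  rewrite rmorphN1 mulN1r scaleN1r addNr => /graph0 /eqP.
  by rewrite addrC subr_eq0 => /eqP.
have /boolp.choice[h hP] : forall w, exists u, graph w u.
  move=> w; have [x [y e]] := cover_square_onto w.
  by exists (ga x - gb y), x, y.
exists h; split.
- by move=> r x y; apply: graph_fun (hP _) _; apply: graphP.
- move=> x; apply: graph_fun _ (hP _); exists x, 0.
  by rewrite rmorph0 addr0 (lin_0 gbP) subr0.
- move=> y; apply: oppr_inj; rewrite opprK; apply: graph_fun _ (hP _).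
  by exists 0, y; rewrite rmorph0 add0r (lin_0 gaP) sub0r.
Qed.

End TwoElementCover.

(** * Extension of a family of maps along principal covers *)

Section Extension.
Variables (R : comPzRingType) (U : lmodType R) (V : zmodType).
Hypothesis U_contra : contraadjusted U.
(* The algebras on which the family [Psi] is prescribed. *)
Variable adm : forall B : comPzRingType, {rmorphism R -> B} -> Prop.
Variable Psi : forall B : comPzRingType, {rmorphism R -> B} -> (B -> U) -> V.

Hypothesis adm_comp : forall (B B' : comPzRingType) (psi : {rmorphism R -> B})
  (psi' : {rmorphism R -> B'}) (beta : {rmorphism B -> B'}),
  (forall r, beta (psi r) = psi' r) -> adm psi -> adm psi'.
Hypothesis PsiD : forall (B : comPzRingType) (psi : {rmorphism R -> B})
  (g h : B -> U), adm psi -> lin psi g -> lin psi h ->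
  Psi psi (fun x => g x + h x) = Psi psi g + Psi psi h.
Hypothesis Psi_comp : forall (B B' : comPzRingType) (psi : {rmorphism R -> B})
  (psi' : {rmorphism R -> B'}) (beta : {rmorphism B -> B'}) (h : B' -> U),
  adm psi -> (forall r, beta (psi r) = psi' r) -> lin psi' h ->
  Psi psi (fun x => h (beta x)) = Psi psi' h.

Lemma Psi0 (B : comPzRingType) (psi : {rmorphism R -> B}) :
  adm psi -> Psi psi (fun _ => 0) = 0.
Proof.
move=> psiA; apply: (addrI (Psi psi (fun _ => 0))).
rewrite addr0 -(PsiD psiA (lin_const0 _ _) (lin_const0 _ _)).
by congr Psi; apply/funext => x; rewrite addr0.
Qed.

Lemma PsiN (B : comPzRingType) (psi : {rmorphism R -> B}) (h : B -> U) :
  adm psi -> lin psi h -> Psi psi (fun x => - h x) = - Psi psi h.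
Proof.
move=> psiA hP; apply/eqP; rewrite -addr_eq0 -PsiD //; last exact: lin_opp.
by apply/eqP; rewrite -(Psi0 psiA); congr Psi; apply/funext => x; rewrite addNr.
Qed.

Definition small (B : comPzRingType) (psi : {rmorphism R -> B}) :=
  adm psi /\ exists c, is_loc psi c.

Lemma small_eq (B : comPzRingType) (psi psi' : {rmorphism R -> B}) :
  psi =1 psi' -> small psi -> small psi'.
Proof.
move=> e [psiA [c [cu locf loc0]]]; split.
  by apply: (adm_comp (beta := idfun)) psiA.
exists c; split=> [|y|x]; rewrite -e //; last exact: loc0.
by have [n [x exy]] := locf y; exists n, x; rewrite -e.
Qed.

(** If [B] is [R[1/c]] and [c^n x] comes from [y] in [R], then [x] and [y] differ by a unit of [B],
    so [B[1/x]] is [R[1/(cy)]]. *)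
Lemma small_loc (B B' : comPzRingType) (psi : {rmorphism R -> B})
    (beta : {rmorphism B -> B'}) x :
  is_loc beta x -> small psi -> small (rcomp psi beta).
Proof.
move=> lx [psiA [c lc]]; split; first by apply: (adm_comp (beta := beta)) psiA.
have [[d cd] /(_ x)[n [y e]] _] := lc; exists (c * y).
apply: is_loc_trans lc _; rewrite -e.
by apply: (is_loc_unitM (d := d ^+ n)) lx; rewrite -exprMn cd expr1n.
Qed.

(** [g] is a finite sum of maps [h_i] restricted along [A -> B_i] with [B_i] small, and [v] is the
    sum of the [Psi(h_i)]. So [v] is the value that any natural additive extension of [Psi] must
    take at [g]; the task is to show that such a [v] exists and is unique. *)
Inductive presents (A : comPzRingType) (phi : {rmorphism R -> A}) :
    (A -> U) -> V -> Prop :=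
| presents0 g : (forall x, g x = 0) -> presents phi g 0
| presentsD (B : comPzRingType) (psi : {rmorphism R -> B})
    (alpha : {rmorphism A -> B}) (h : B -> U) (g g' : A -> U) (v : V) :
    small psi -> (forall r, alpha (phi r) = psi r) -> lin psi h ->
    presents phi g v -> (forall x, g' x = h (alpha x) + g x) ->
    presents phi g' (Psi psi h + v).

Lemma presents_comp (A A' : comPzRingType) (phi : {rmorphism R -> A})
    (phi' : {rmorphism R -> A'}) (alpha : {rmorphism A -> A'}) g v :
  (forall r, alpha (phi r) = phi' r) -> presents phi' g v ->
  presents phi (fun x => g (alpha x)) v.
Proof.
move=> e; elim=> [{}g g0|B psi beta h {}g g' {}v psiS betaP hP _ IHg eg].
  exact: presents0.
apply: (presentsD (alpha := rcomp alpha beta)) IHg _ => // r.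
by rewrite /= e betaP.
Qed.

Lemma presents_small (A B : comPzRingType) (phi : {rmorphism R -> A})
    (psi : {rmorphism R -> B}) (alpha : {rmorphism A -> B}) (h : B -> U) :
  small psi -> (forall r, alpha (phi r) = psi r) -> lin psi h ->
  presents phi (fun x => h (alpha x)) (Psi psi h).
Proof.
move=> psiS e hP; rewrite -[Psi _ _]addr0.
apply: (presentsD (g := fun _ => 0) (alpha := alpha)) => //.
  by apply: presents0.
by move=> x; rewrite addr0.
Qed.

Section Presents.
Variables (A : comPzRingType) (phi : {rmorphism R -> A}).

Lemma presents_add g v g' v' : presents phi g v -> presents phi g' v' ->
  presents phi (fun x => g x + g' x) (v + v').
Proof.
move=> gv gv'.
elim: gv => [{}g g0|B psi beta h {}g g2 {}v psiS betaP hP _ IHg eg].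
  rewrite add0r; suff -> : (fun x => g x + g' x) = g' by [].
  by apply/funext => x; rewrite g0 add0r.
rewrite -addrA; apply: (presentsD (alpha := beta)) IHg _ => // x.
by rewrite eg addrA.
Qed.

Lemma presents_opp g v :
  presents phi g v -> presents phi (fun x => - g x) (- v).
Proof.
elim=> [{}g g0|B psi beta h {}g g' {}v psiS betaP hP _ IHg eg].
  by rewrite oppr0; apply: presents0 => x; rewrite g0 oppr0.
rewrite opprD -(PsiN psiS.1 hP).
apply: (presentsD (alpha := beta)) IHg _ => //; first exact: lin_opp.
by move=> x; rewrite eg opprD.
Qed.

Lemma presents_lin g v : presents phi g v -> lin phi g.
Proof.
elim=> [{}g g0|B psi beta h {}g g' {}v psiS betaP hP _ IHg eg] r x y.
  by rewrite !g0 scaler0 addr0.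
by rewrite !eg IHg rmorphD rmorphM betaP hP scalerDr addrACA.
Qed.

End Presents.

(** A finite principal cover by small pieces, as an induction: one small piece [D(b)] is split off,
    and the rest covers [D(a)]. *)
Inductive covered : forall A : comPzRingType, {rmorphism R -> A} -> Prop :=
| covered0 (A : comPzRingType) (phi : {rmorphism R -> A}) :
    1 = 0 :> A -> covered phi
| coveredS (A Aa Ab : comPzRingType) (phi : {rmorphism R -> A})
    (alpha : {rmorphism A -> Aa}) (beta : {rmorphism A -> Ab}) (a b : A) :
    a + b = 1 -> is_loc alpha a -> is_loc beta b ->
    covered (rcomp phi alpha) -> small (rcomp phi beta) -> covered phi.

Lemma square_small (A Aa Ab C : comPzRingType) (a b : A)
    (phi : {rmorphism R -> A})
    (alpha : {rmorphism A -> Aa}) (beta : {rmorphism A -> Ab})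
    (alpha' : {rmorphism Aa -> C}) (beta' : {rmorphism Ab -> C}) :
  cover_square a b alpha beta alpha' beta' ->
  is_loc beta' (beta a) -> small (rcomp phi beta) ->
  small (rcomp phi (rcomp alpha alpha')).
Proof.
case=> _ _ _ comm _ lb betaS; apply: small_eq (small_loc lb betaS) => r.
by rewrite /= comm.
Qed.

(* Every map on a small algebra [B] occurring in [g] has to be cut in two by *)
(* [lin_split], which needs [B] localized at [a * b] to be principal over R. *)
Lemma presents_split (A Aa Ab : comPzRingType) (phi : {rmorphism R -> A})
    (alpha : {rmorphism A -> Aa}) (beta : {rmorphism A -> Ab}) (a b : A) g v :
  a + b = 1 -> is_loc alpha a -> is_loc beta b -> small (rcomp phi beta) ->
  presents phi g v ->
  exists ga gb va, [/\ presents (rcomp phi alpha) ga va,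
    lin (rcomp phi beta) gb,
    (forall x, g x = ga (alpha x) + gb (beta x)) &
    v = va + Psi (rcomp phi beta) gb].
Proof.
move=> ab la lb betaS.
elim=> [{}g g0|B psi chi h {}g g' {}v psiS chiP hP _ IHg eg'].
  exists (fun _ => 0), (fun _ => 0), 0; split.
  - by apply: presents0.
  - exact: lin_const0.
  - by move=> x; rewrite g0 addr0.
  - by rewrite Psi0 ?addr0 //; case: betaS.
have [ga [gb [va [gaP gbP eg ev]]]] := IHg.
have chi_ab : chi a + chi b = 1 by rewrite -rmorphD ab rmorph1.
(* The cover of [Spec A] is pulled back to [B]. Below, [ka] and [kb] map [A_a] and [A_b] to the
   corresponding pieces of [B]. *)
pose la' := is_loc_elt (chi a); pose lb' := is_loc_elt (chi b).
pose lab' := is_loc_elt (loc_elt_inj (chi b) (chi a)).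
have [xi sq] := cover_square_exists chi_ab la' lb' lab'.
have [_ [c cP]] := square_small sq lab' (small_loc lb' psiS).
have [ha [hb [haP hbP eh]]] := lin_split sq cP U_contra hP.
have [ka kaP] := is_loc_lift (psi := rcomp chi (loc_elt_inj (chi a))) la
  (let: And3 e _ _ := la' in e).
have [kb kbP] := is_loc_lift (psi := rcomp chi (loc_elt_inj (chi b))) lb
  (let: And3 e _ _ := lb' in e).
have ka_phi r : ka (rcomp phi alpha r) = rcomp psi (loc_elt_inj (chi a)) r.
  by rewrite /= kaP /= chiP.
have kb_phi r : kb (rcomp phi beta r) = rcomp psi (loc_elt_inj (chi b)) r.
  by rewrite /= kbP /= chiP.
exists (fun x => ha (ka x) + ga x), (fun x => hb (kb x) + gb x).
exists (Psi (rcomp psi (loc_elt_inj (chi a))) ha + va); split.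
- by apply: (presentsD (alpha := ka)) gaP _ => //; apply: small_loc la' psiS.
- by apply: lin_add => //; apply: lin_comp hbP.
- by move=> x; rewrite eg' eg eh kaP kbP addrACA.
have hbk : lin (rcomp phi beta) (fun x => hb (kb x)) by apply: lin_comp hbP.
rewrite PsiD //; last by case: betaS.
rewrite (Psi_comp betaS.1 kb_phi hbP) ev addrACA; congr (_ + _).
have psiA := psiS.1.
have -> : h = fun x => ha (loc_elt_inj (chi a) x) + hb (loc_elt_inj (chi b) x).
  by apply/funext.
rewrite PsiD //; [|exact: lin_comp haP|exact: lin_comp hbP].
by congr (_ + _); apply: Psi_comp.
Qed.

(** Existence follows by cutting [g] along the cover. For uniqueness, a presentation of 0 is cut
    into [ga] on [A_a] and [gb] on [A_b], which cancel on [A]. Both then come from one [h] on the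
    small algebra [A_ab], up to sign, and their values [Psi(h)] and [- Psi(h)] cancel. *)
Lemma covered_presents (A : comPzRingType) (phi : {rmorphism R -> A}) :
  covered phi ->
  (forall g, lin phi g -> exists v, presents phi g v) /\
  (forall g v, (forall x, g x = 0) -> presents phi g v -> v = 0).
Proof.
elim=> {A phi} [A phi A0|A Aa Ab phi alpha beta a b ab la lb _ [IHtot IHfun]].
  split=> [g gP|g v _].
    exists 0; apply: presents0 => x.
    by rewrite -[x]mulr1 A0 mulr0; apply: lin_0 gP.
  elim=> [//|B psi beta h {}g g' {}v psiS _ hP _ -> _]; rewrite addr0.
  rewrite -(Psi0 psiS.1); congr Psi; apply/funext => x.
  rewrite -[x]mulr1 -(rmorph1 beta) A0 rmorph0 mulr0; exact: lin_0 hP.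
move=> betaS; pose lc := is_loc_elt (beta a).
have [alpha' sq] := cover_square_exists ab la lb lc.
have gammaS := square_small sq lc betaS.
have [_ [c cP]] := gammaS; split=> [g gP|g v g0].
  have [ga [gb [gaP gbP eg]]] := lin_split sq cP U_contra gP.
  have [va gav] := IHtot _ gaP.
  exists (va + Psi (rcomp phi beta) gb).
  have -> : g = fun x => ga (alpha x) + gb (beta x) by apply/funext.
  apply: presents_add; first exact: presents_comp gav.
  by apply: presents_small.
move=> /(presents_split ab la lb betaS)[ga [gb [va [gaP gbP eg ->]]]].
have [|h [hP gah gbh]] := lin_glue sq (presents_lin gaP) gbP.
  by move=> x; rewrite -eg g0.
(* The difference of [ga] and the restriction of [h] is 0, and [A_a] is covered, so uniqueness over
   [A_a] applies to it. *)
have va_h : va = Psi (rcomp phi (rcomp alpha alpha')) h.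
  apply/eqP; rewrite -subr_eq0; apply/eqP.
  apply: (IHfun (fun x => ga x - h (alpha' x))).
    by move=> x; rewrite gah subrr.
  apply: presents_add gaP _; apply: presents_opp.
  by apply: presents_small.
have -> : gb = fun y => - h (loc_elt_inj (beta a) y) by apply/funext.
have [_ _ _ comm _] := sq; have betaA := betaS.1.
have e r : loc_elt_inj (beta a) (rcomp phi beta r)
    = rcomp phi (rcomp alpha alpha') r by rewrite /= comm.
rewrite PsiN //; last exact: lin_comp hP.
by rewrite (Psi_comp betaA e hP) va_h subrr.
Qed.

Lemma covered_span (A : comPzRingType) (phi : {rmorphism R -> A})
    (m : nat) (t s : 'I_m -> A) :
  (forall i, exists (B : comPzRingType) (beta : {rmorphism A -> B}),
     is_loc beta (s i) /\ small (rcomp phi beta)) ->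
  \sum_i t i * s i = 1 -> covered phi.
Proof.
elim: m A phi t s => [|m IHm] A phi t s sP.
  by rewrite big_ord0 => A0; apply: covered0.
rewrite big_ord_recr /=; set a := \sum_(i < m) _; set b := _ * _ => ab.
have [B [beta [lbeta betaS]]] := sP ord_max.
pose la := is_loc_elt a; pose lb' := is_loc_elt (beta (t ord_max)).
apply: (@coveredS A _ _ phi _ (rcomp beta _) a b ab la).
- by rewrite /b mulrC; apply: is_loc_trans lbeta lb'.
(* In [A_a], multiplying [a = sum_(i < m) t_i s_i] by the inverse [d] of [a] gives a relation for 1
   with one term fewer. *)
- have [d ad] : exists d, loc_elt_inj a a * d = 1 by case: la.
  pose w i := widen_ord (leqnSn m) i : 'I_m.+1.
  apply: (IHm _ _ (fun i => d * loc_elt_inj a (t (w i)))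
    (fun i => loc_elt_inj a (s (w i)))).
    (* The piece at [s_i] of [A_a] is taken to be the piece of [A] at [s_i], localized at [a]; this
       keeps it small. *)
    move=> i; have [B' [beta' [lbeta' betaS']]] := sP (w i).
    have la' := is_loc_elt (beta' a).
    have [ka kaP] := is_loc_lift (psi := rcomp beta' (loc_elt_inj (beta' a))) la
      (let: And3 e _ _ := la' in e).
    exists (loc_elt (beta' a)), ka; split.
      apply: is_loc_factor la _; have := is_loc_trans lbeta' la'; rewrite mulrC.
      move=> [[d' e1] e2 e3]; split.
      - by exists d'; rewrite /= kaP.
      - by move=> y; have [n [x exy]] := e2 y; exists n, x; rewrite /= !kaP.
      - by move=> x; rewrite /= kaP; apply: e3.
    apply: small_eq (small_loc la' betaS') => r.
    by rewrite /= kaP.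
  under eq_bigr => i _ do rewrite -mulrA -rmorphM.
  by rewrite -mulr_sumr -rmorph_sum /= mulrC.
- exact: small_eq (small_loc lb' betaS).
Qed.

End Extension.

(** * Open immersions of affine schemes *)

Section PrimeIdeals.
Variable A : comPzRingType.
Local Open Scope classical_set_scope.

Definition ideal_set (I : set A) :=
  [/\ I 0, forall x y, I x -> I y -> I (x + y) & forall a x, I x -> I (a * x)].

(** An ideal maximal among those containing [I] and missing all powers of [e] is prime. *)
Lemma prime_avoiding (I : set A) (e : A) :
  ideal_set I -> (forall n, ~ I (e ^+ n)) ->
  exists p : Spec A, I `<=` p /\ ~ spec_set p e.
Proof.
move=> [I0 ID IM] Ie.
(* Zorn's lemma wants the empty chain to be bounded by its union [set0]:     *)
(* hence the ideals are parametrized by [J |-> I `|` J].                     *)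
pose P (J : set A) := ideal_set (I `|` J) /\ forall n, ~ (I `|` J) (e ^+ n).
have [F FP Ftot|J [[[Q0 QD QM] Qe] Jmax]] := @Zorn_bigcup A P.
  have pick x y :
      (I `|` \bigcup_(X in F) X) x -> (I `|` \bigcup_(X in F) X) y ->
      (I x /\ I y) \/ exists2 X, F X & (I `|` X) x /\ (I `|` X) y.
    move=> [Ix|[X FX Xx]] [Iy|[Y FY Yy]]; first by left.
    - by right; exists Y => //; split; [left|right].
    - by right; exists X => //; split; [right|left].
    - right; have [XY|YX] := Ftot _ _ FX FY.
        by exists Y => //; split; right => //; apply: XY.
      by exists X => //; split; right => //; apply: YX.
  split; first split.
  - by left.
  - move=> x y xU yU; have [[Ix Iy]|[X FX [xX yX]]] := pick _ _ xU yU.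
      by left; apply: ID.
    have [[_ XD _] _] := FP _ FX.
    by have [?|?] := XD _ _ xX yX; [left | right; exists X].
  - move=> a x [Ix|[X FX Xx]]; first by left; apply: IM.
    have [[_ _ XM] _] := FP _ FX.
    by have [?|?] := XM a x (or_intror Xx); [left | right; exists X].
  - move=> n [/Ie//|[X FX Xe]].
    by have [_ /(_ n)] := FP _ FX; apply; right.
pose Q := I `|` J.
have extend x : ~ Q x -> exists n q a, Q q /\ e ^+ n = q + a * x.
  move=> Qx; apply: contrapT => no.
  pose Q' : set A := [set z | exists q a, Q q /\ z = q + a * x].
  have QQ' : Q `<=` Q' by move=> q Qq; exists q, 0; rewrite mul0r addr0.
  have IQ' : I `|` Q' = Q'.
    by apply/seteqP; split=> z; [case=> // Iz; apply: QQ'; left | right].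
  apply: (Jmax Q'); last first.
    split; rewrite IQ'; last first.
      by move=> n [q [a [Qq eq]]]; apply: no; exists n, q, a.
    split.
    - by apply: QQ'.
    - move=> _ _ [q [a [Qq ->]]] [q' [a' [Qq' ->]]].
      by exists (q + q'), (a + a'); split; [apply: QD | ring].
    - move=> b _ [q [a [Qq ->]]].
      by exists (b * q), (b * a); split; [apply: QM | ring].
  split; first by move=> z Jz; apply: QQ'; right.
  move=> /(_ x) Q'J; apply: Qx; right; apply: Q'J.
  by exists 0, 1; rewrite mul1r add0r.
have Qprime : prime_ideal Q.
  split=> //; first exact: (Qe 0%N).
  move=> x y Qxy; apply: contrapT => /not_orP[].
  move=> /extend[n [q [a [Qq en]]]] /extend[m [q' [b [Qq' em]]]].
  apply: (Qe (n + m)%N); rewrite exprD en em.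
  have -> : (q + a * x) * (q' + b * y)
      = (q' + b * y) * q + ((a * x) * q' + (a * b) * (x * y)) by ring.
  by apply: (QD); last apply: QD; apply: QM.
exists (MkSpec Qprime); split; first by move=> z Iz; left.
exact: (Qe 1%N).
Qed.

Lemma prime_exp (p : Spec A) x n : spec_set p (x ^+ n) -> spec_set p x.
Proof.
have [_ _ _ p1 pP] := specP p.
elim: n => [|n IHn]; first by rewrite expr0.
by rewrite exprS => /pP[].
Qed.

(** Otherwise the ideal generated by [E] is proper and lies in a prime, which then contains all of
    [E]. *)
Lemma span_one (E : set A) :
  (forall p : Spec A, exists2 x, E x & ~ spec_set p x) ->
  exists m (t s : 'I_m -> A), (forall i, E (s i)) /\ \sum_i t i * s i = 1.
Proof.
move=> cov; apply: contrapT => no.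
pose I : set A := [set x | exists m (t s : 'I_m -> A),
  (forall i, E (s i)) /\ \sum_i t i * s i = x].
have idI : ideal_set I.
  split.
  - exists 0%N, (fun _ => 0), (fun _ => 0).
    by split=> [[]//|]; rewrite big_ord0.
  - move=> _ _ [m [t [s [sE <-]]]] [m' [t' [s' [sE' <-]]]].
    exists (m + m')%N,
      (fun i => match fintype.split i with inl j => t j | inr j => t' j end),
      (fun i => match fintype.split i with inl j => s j | inr j => s' j end).
    split=> [i|]; first by case: (fintype.split i).
    rewrite big_split_ord; congr (_ + _); apply: eq_bigr => i _.
      by rewrite (unsplitK (inl i : 'I_m + 'I_m')).
    by rewrite (unsplitK (inr i : 'I_m + 'I_m')).
  - move=> a _ [m [t [s [sE <-]]]]; exists m, (fun i => a * t i), s; split=> //.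
    by rewrite mulr_sumr; apply: eq_bigr => i _; rewrite mulrA.
have [|p [Ip _]] := prime_avoiding (e := 1) idI.
  by move=> n; rewrite expr1n.
have [x Ex px] := cov p; apply/px/Ip.
exists 1%N, (fun _ => 1), (fun _ => x); split=> //.
by rewrite big_ord1 mul1r.
Qed.

End PrimeIdeals.

Section OpenImmersions.
Variables (A B : comPzRingType) (phi : {rmorphism A -> B}).
Local Open Scope classical_set_scope.

(** Surjectivity and injectivity of [A[1/e] -> B[1/phi(e)]], with denominators cleared. *)
Definition iso_after_inverting (e : A) :=
  (forall y, exists n x, phi e ^+ n * y = phi x) /\
  (forall x, phi x = 0 -> exists n, e ^+ n * x = 0).

Lemma iso_after_inverting_loc (C : comPzRingType)
    (beta : {rmorphism B -> C}) e :
  iso_after_inverting e -> is_loc beta (phi e) -> is_loc (rcomp phi beta) e.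
Proof.
move=> [locf loc0] [u locf' loc0']; split=> //.
  move=> z; have [n [y ey]] := locf' z; have [m [x ex]] := locf y.
  exists (m + n)%N, x; rewrite /= exprD -mulrA ey -rmorphXn -rmorphM.
  by rewrite ex.
move=> x /loc0'[n]; rewrite -rmorphXn -rmorphM => /loc0[m e0].
by exists (m + n)%N; rewrite exprD -mulrA.
Qed.

Hypothesis phi_open : open_immersion phi.

(** The image of [D(u)] is open, so it contains a neighbourhood [D(a)] of the image of [q]. By
    injectivity on spectra [D(phi a)] lies in [D(u)], whence a power of [phi a] is a multiple of
    [u]. Denominators outside [q] can thus be taken from [A]. *)
Lemma open_immersion_unit (q : Spec B) u : ~ spec_set q u ->
  exists2 a, ~ spec_set q (phi a) & exists n w, phi a ^+ n = w * u.
Proof.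
case: phi_open => inj _ opn _ qu.
have [F imE] :
    zariski_open (spec_map phi @` [set q' : Spec B | ~ [set u] `<=` q']).
  by apply: opn; exists [set u].
have imF p : (spec_map phi @` [set q' : Spec B | ~ [set u] `<=` q']) p
    <-> ~ F `<=` p by rewrite imE.
have [a Fa qa] : exists2 a, F a & ~ spec_set q (phi a).
  have /imF/existsNP[a /not_implyP[Fa qa]] :
      (spec_map phi @` [set q' : Spec B | ~ [set u] `<=` q']) (spec_map phi q).
    by exists q => // uq; apply/qu/uq.
  by exists a.
exists a => //; apply: contrapT => no.
have [|n [w aw]|q' [uq' q'a]] :=
  @prime_avoiding B [set z | exists w, z = w * u] (phi a).
- split; first by exists 0; rewrite mul0r.
    by move=> _ _ [w ->] [w' ->]; exists (w + w'); rewrite mulrDl.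
  by move=> b _ [w ->]; exists (b * w); rewrite mulrA.
- by apply: no; exists n, w.
have /imF[q3 uq3 /inj e] : ~ F `<=` spec_map phi q' by move=> /(_ _ Fa).
apply: uq3; rewrite e => _ ->.
by apply: uq'; exists 1; rewrite mul1r.
Qed.

(** Take [D(e)] around the image of [q] and inside the image of [Spec B]. If no power of [e] lay in
    the ideal of denominators of [y], or in the annihilator of [x], that ideal would sit in a prime
    [p] of [D(e)]. Such a [p] comes from [Spec B], and the bijection of stalks there yields an
    element of the ideal outside [p]. *)
Lemma open_immersion_local (q : Spec B) :
  exists2 e, ~ spec_set q (phi e) & iso_after_inverting e.
Proof.
case: (phi_open) => inj _ opn bij.
have [E imE] : zariski_open (spec_map phi @` setT) by apply: opn; apply: openT.
have imF p : (spec_map phi @` setT) p <-> ~ E `<=` p by rewrite imE.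
have [e Ee qe] : exists2 e, E e & ~ spec_set q (phi e).
  have /imF/existsNP[e /not_implyP[Ee qe]] :
      (spec_map phi @` setT) (spec_map phi q).
    by exists q.
  by exists e.
have lift (p : Spec A) : ~ spec_set p e -> exists q', spec_map phi q' = p.
  move=> pe; have /imF[q' _ <-] : ~ E `<=` p by move=> /(_ _ Ee).
  by exists q'.
exists e => //; split=> [y|x x0].
  apply: contrapT => no.
  have [|n [x ex]|p [Jp pe]] :=
    @prime_avoiding A [set a | exists x, phi a * y = phi x] e.
  - split; first by exists 0; rewrite !rmorph0 mul0r.
      move=> a b [x ex] [z ez]; exists (x + z).
      by rewrite !rmorphD mulrDl ex ez.
    by move=> b a [x ex]; exists (b * x); rewrite !rmorphM -mulrA ex.
  - by apply: no; exists n, x; rewrite -rmorphXn.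
  have [q' e'] := lift p pe; rewrite -{p}e' in Jp pe.
  have [g _ gK] := bij q'; have := gK (Defs.frac (y, den1 _)).
  rewrite -(fracK (g _)); case: (repr _) => x s.
  rewrite /stalk_map loc_mapE => /fracP[u /asboolP qu /= eu].
  (* The equality of fractions holds after multiplying by some [u] of [B]; replacing [u] by [a^n]
     makes [a^n s] a denominator of [y] in [A]. *)
  have [a qa [n [w aw]]] := open_immersion_unit qu.
  have sp : ~ spec_set (spec_map phi q') (sval s).
    by apply/asboolP; exact: (valP s).
  have [_ _ _ _ pP] := specP (spec_map phi q').
  have : spec_set (spec_map phi q') (a ^+ n * sval s).
    apply: Jp; exists (a ^+ n * x); rewrite !rmorphM rmorphXn aw.
    rewrite mulr1 in eu; rewrite -!mulrA eu [y * _]mulrC //.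
  by move=> /pP[/prime_exp|].
apply: contrapT => no.
have [|n e0|p [Ip pe]] := @prime_avoiding A [set a | a * x = 0] e.
- split=> [|a b ax bx|b a ax] /=; first exact: mul0r.
    by rewrite mulrDl ax bx addr0.
  by rewrite -mulrA ax mulr0.
- by apply: no; exists n.
have [q' e'] := lift p pe; rewrite -{p}e' in Ip pe.
have [g gK _] := bij q'.
have : Defs.frac (x, den1 _) = Defs.frac (0, den1 _) :> stalk (spec_map phi q').
  apply: (can_inj gK); rewrite /stalk_map !loc_mapE; apply/fracP.
  by exists 1; rewrite ?rpred1 //= x0 rmorph0.
move=> /fracP[u /asboolP pu /=]; rewrite !mulr1 mulr0 => ux.
exact/pu/Ip.
Qed.

End OpenImmersions.

(** * Gluing differential operators *)

(** The map [a (x) b |-> sigma(a) tau(b)], kept as an [R]-linear function because it serves to pull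
    back linear maps from [C] to the tensor product. *)
Lemma tens_lift (R A B C : comPzRingType) (phi : {rmorphism R -> A})
    (psi : {rmorphism R -> B}) (chi : {rmorphism R -> C})
    (sigma : {rmorphism A -> C}) (tau : {rmorphism B -> C}) :
  (forall r, sigma (phi r) = chi r) -> (forall r, tau (psi r) = chi r) ->
  exists mu : tens phi psi -> C,
    (forall a b, mu (tpure phi psi a b) = sigma a * tau b) /\
    forall r x y,
      mu (rcomp phi (tens_inl phi psi) r * x + y) = chi r * mu x + mu y.
Proof.
move=> e e'; pose val (s : seq (A * B)) := \sum_(x <- s) sigma x.1 * tau x.2.
have val_cat s t : val (s ++ t) = val s + val t by rewrite /val big_cat.
have val_rel s t : tens_rel phi psi s t -> val s = val t.
  elim=> {s t}.
  - by [].
  - by [].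
  - by move=> s t u _ -> _ ->.
  - by move=> s s' t t' _ IHs _ IHt; rewrite !val_cat IHs IHt.
  - by move=> s t; rewrite !val_cat addrC.
  - by move=> b; rewrite /val big_seq1 big_nil /= rmorph0 mul0r.
  - move=> a a' b; rewrite /val big_seq1 big_cons big_seq1 /=.
    by rewrite rmorphD mulrDl.
  - move=> a b b'; rewrite /val big_seq1 big_cons big_seq1 /=.
    by rewrite rmorphD mulrDr.
  - by move=> r a b; rewrite /val !big_seq1 /= !rmorphM e e'; ring.
pose mu (x : tens phi psi) := val (repr x).
have muE s : mu (tsum phi psi s) = val s by apply/val_rel/tsumP; rewrite tsumK.
exists mu; split=> [a b|r x y]; first by rewrite /tpure muE /val big_seq1.
have -> : rcomp phi (tens_inl phi psi) r = tsum phi psi [:: (phi r, 1)] by [].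
rewrite -(tsumK x) -(tsumK y) tsum_mul -tsum_cat !muE val_cat.
congr (_ + _); rewrite /val /= cats0 big_map mulr_sumr.
apply: eq_bigr => z _ /=.
by rewrite rmorphM e mul1r mulrA.
Qed.

Section DifferentialOperators.
Variables (K R : comPzRingType) (f : {rmorphism K -> R}).
Variables (U V : lmodType R) (D : U -> V).

Lemma diffopD x y : diffop f D -> D (x + y) = D x + D y.
Proof. by case=> /(_ 1 x y) + _; rewrite !scale1r. Qed.

Lemma diffopZ k x : diffop f D -> D (f k *: x) = f k *: D x.
Proof.
move=> DP; have D0 : D 0 = 0.
  by apply: (addrI (D 0)); rewrite -(diffopD _ _ DP) !addr0.
have [/(_ k x 0) + _] := DP; rewrite /= addr0 D0 addr0.
by [].
Qed.

Lemma iter_thetaD r n x y :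
  (forall u v, D (u + v) = D u + D v) ->
  iter n (theta r) D (x + y) = iter n (theta r) D x + iter n (theta r) D y.
Proof.
move=> DD; elim: n x y => [|n IHn] x y //=.
by rewrite /theta scalerDr !IHn scalerDr opprD addrACA.
Qed.

Lemma iter_theta_eq0 r n m :
  (forall u, iter n (theta r) D u = 0) ->
  forall u, iter (m + n) (theta r) D u = 0.
Proof.
move=> D0; elim: m => [//|m IHm] u.
by rewrite addSn iterS /theta !IHm scaler0 subr0.
Qed.

(** Evaluation at 1 carries the action of [phi r] to that of [r], so it carries [theta (phi r)] to
    [theta r]. This transfers the order of [D_l] to [D]. *)
Lemma iter_theta_coind (A : comPzRingType) (phi : {rmorphism R -> A})
    (E : coind phi U -> coind phi V) r n g :
  (forall g, E g 1 = D (g 1)) ->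
  iter n (theta (phi r)) E g 1 = iter n (theta r) D (g 1).
Proof.
move=> ED; elim: n g => [|n IHn] g /=; first exact: ED.
have evalZ (M : lmodType R) (h : coind phi M) : (phi r *: h) 1 = r *: h 1.
  by rewrite coind_scaleE coindZ.
transitivity (r *: iter n (theta (phi r)) E g 1
    - iter n (theta (phi r)) E (phi r *: g) 1); first by rewrite -evalZ.
by rewrite !IHn evalZ.
Qed.

End DifferentialOperators.

Section Gluing.
Variables (K R : comPzRingType) (f : {rmorphism K -> R}) (n : nat).
Variables (S : 'I_n -> comPzRingType).
Variables (phi : forall l : 'I_n, {rmorphism R -> S l}).
Variables (U V : lmodType R).
Variable D : forall l : 'I_n, coind (phi l) U -> coind (phi l) V.

(* [v] is the value at [1] of the operator induced on [Hom_R(B, U)] by any   *)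
(* of the [D l] such that [B] is an algebra over [S l].                      *)
Definition local_value_spec (B : comPzRingType) (psi : {rmorphism R -> B})
    (h : B -> U) (v : V) :=
  exists l (sigma : {rmorphism S l -> B}) (G : coind (phi l) U),
    [/\ forall r, sigma (phi l r) = psi r, forall x, G x = h (sigma x) &
     v = D G 1].

(** For [h] linear on an algebra over some [S l] a value exists, and [D_compat] makes it unique; the
    default 0 is returned when there is none. *)
Definition local_value (B : comPzRingType) (psi : {rmorphism R -> B})
    (h : B -> U) : V :=
  xget 0 [set v | local_value_spec psi h v]%classic.

Definition local_algebra (B : comPzRingType) (psi : {rmorphism R -> B}) :=
  exists l (sigma : {rmorphism S l -> B}), forall r, sigma (phi l r) = psi r.

Lemma lin_coind (A : comPzRingType) (chi : {rmorphism R -> A}) (g : A -> U) :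
  lin chi g -> exists G : coind chi U, forall x, G x = g x.
Proof. by move=> gP; exists (Coind (phi := chi) (coind_fun := g) gP). Qed.

Lemma coind_lin (A : comPzRingType) (chi : {rmorphism R -> A})
  (G : coind chi U) : lin chi G.
Proof. by move=> r x y; apply: coindE. Qed.

Variable D2 : forall j l : 'I_n,
  coind (rcomp (phi j) (tens_inl (phi j) (phi l))) U ->
  coind (rcomp (phi j) (tens_inl (phi j) (phi l))) V.
Hypothesis D2_induced : forall j l : 'I_n,
  induced (rcomp f (phi j)) (tens_inl (phi j) (phi l)) (@D j)
    (fun g => coind_curry (D2 (coind_uncurry g))).
Hypothesis D2_compat : forall (j l : 'I_n)
  (h : coind (rcomp (phi l) (tens_inl (phi l) (phi j))) U),
  @D2 j l (coind_swap h) = coind_swap (@D2 l j h).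

Lemma D_D2 j l (h : coind (rcomp (phi j) (tens_inl (phi j) (phi l))) U)
    (G : coind (phi j) U) :
  (forall x, G x = h (tpure _ _ x 1)) -> D G 1 = D2 h 1.
Proof.
move=> Gh; have [_ /(_ (coind_curry h))] := D2_induced j l.
have -> : coind_curry h 1 = G.
  by apply: coindP => x; rewrite coind_curryE mulr1 Gh.
move=> <-; rewrite coind_curryK coind_curryE; congr (D2 h _).
by rewrite rmorph1 mulr1.
Qed.

(** [tau] and [sigma] combine to [mu] from the tensor product of [S j] and [S l] to [B]. By [D_D2]
    both sides are values at [1 (x) 1] of the operators induced on [h \o mu], which agree since the
    swap fixes 1. *)
Lemma D_compat (B : comPzRingType) (psi : {rmorphism R -> B}) (h : B -> U)
    j l (sigma : {rmorphism S l -> B}) (tau : {rmorphism S j -> B})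
    (G : coind (phi l) U) (G' : coind (phi j) U) :
  (forall r, sigma (phi l r) = psi r) -> (forall r, tau (phi j r) = psi r) ->
  lin psi h -> (forall x, G x = h (sigma x)) -> (forall x, G' x = h (tau x)) ->
  D G 1 = D G' 1.
Proof.
move=> sigmaP tauP hP Gh G'h.
have [mu [muE muP]] := tens_lift tauP sigmaP.
have hmu : lin (rcomp (phi j) (tens_inl (phi j) (phi l))) (h \o mu).
  by move=> r x y /=; rewrite muP hP.
have [H HE] := lin_coind hmu.
rewrite (@D_D2 j l H) => [|x]; last by rewrite HE /= muE rmorph1 mulr1.
rewrite (@D_D2 l j (coind_swap H)) => [|x].
  by rewrite D2_compat [LHS]/(D2 H (tens_swap _ _ 1)) rmorph1.
transitivity (H (tens_swap (phi l) (phi j) (tpure _ _ x 1))); last by [].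
by rewrite tens_swapE HE /= muE rmorph1 mul1r.
Qed.

Lemma local_valueE (B : comPzRingType) (psi : {rmorphism R -> B}) (h : B -> U)
    l (sigma : {rmorphism S l -> B}) (G : coind (phi l) U) :
  lin psi h -> (forall r, sigma (phi l r) = psi r) ->
  (forall x, G x = h (sigma x)) -> local_value psi h = D G 1.
Proof.
move=> hP sigmaP Gh; rewrite /local_value.
case: xgetP => [v -> [j [tau [G' [tauP G'h ->]]]]|no].
  exact: D_compat tauP sigmaP hP G'h Gh.
by case: (no (D G 1)); exists l, sigma, G.
Qed.

Hypothesis D_diffop : forall l, diffop (rcomp f (phi l)) (@D l).

Lemma local_valueD (B : comPzRingType) (psi : {rmorphism R -> B})
    (g h : B -> U) :
  local_algebra psi -> lin psi g -> lin psi h ->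
  local_value psi (fun x => g x + h x) = local_value psi g + local_value psi h.
Proof.
move=> [l [sigma sigmaP]] gP hP.
have [G GE] := lin_coind (lin_comp sigmaP gP).
have [H HE] := lin_coind (lin_comp sigmaP hP).
rewrite (local_valueE gP sigmaP GE) (local_valueE hP sigmaP HE).
rewrite (local_valueE (G := G + H) (lin_add gP hP) sigmaP).
  by rewrite (diffopD _ _ (@D_diffop l)).
by move=> x; rewrite coind_addE GE HE.
Qed.

Lemma local_value_comp (B B' : comPzRingType) (psi : {rmorphism R -> B})
    (psi' : {rmorphism R -> B'}) (beta : {rmorphism B -> B'}) (h : B' -> U) :
  local_algebra psi -> (forall r, beta (psi r) = psi' r) -> lin psi' h ->
  local_value psi (fun x => h (beta x)) = local_value psi' h.
Proof.
move=> [l [sigma sigmaP]] betaP hP.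
have sbP r : rcomp sigma beta (phi l r) = psi' r by rewrite /= sigmaP betaP.
have [G GE] := lin_coind (lin_comp sbP hP).
rewrite (local_valueE hP sbP GE).
by rewrite (local_valueE (lin_comp betaP hP) sigmaP GE).
Qed.

Lemma local_algebra_comp (B B' : comPzRingType) (psi : {rmorphism R -> B})
    (psi' : {rmorphism R -> B'}) (beta : {rmorphism B -> B'}) :
  (forall r, beta (psi r) = psi' r) -> local_algebra psi -> local_algebra psi'.
Proof.
move=> betaP [l [sigma sigmaP]]; exists l, (rcomp sigma beta) => r.
by rewrite /= sigmaP betaP.
Qed.

Hypothesis phi_cover : affine_open_covering phi.

Lemma small_at_iso l (e : R) : iso_after_inverting (phi l) e ->
  small (@local_algebra) (rcomp (phi l) (loc_elt_inj (phi l e))).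
Proof.
move=> le; split; first by exists l, (loc_elt_inj (phi l e)).
by exists e; apply: iso_after_inverting_loc le (is_loc_elt _).
Qed.

Lemma covered_piece l : covered (@local_algebra) (phi l).
Proof.
have [opn _] := phi_cover.
have [|m [t [s [sP st]]]] := @span_one (S l)
    [set x | exists2 e, iso_after_inverting (phi l) e & x = phi l e]%classic.
  move=> q; have [e qe le] := open_immersion_local (opn l) q.
  by exists (phi l e) => //; exists e.
apply: (covered_span local_algebra_comp _ st) => i.
have [e le ->] := sP i; exists (loc_elt (phi l e)), (loc_elt_inj (phi l e)).
by split; [apply: is_loc_elt | apply: small_at_iso].
Qed.

Lemma covered_base : covered (@local_algebra) (idfun : {rmorphism R -> R}).
Proof.
have [opn cov] := phi_cover.
have [|m [t [s [sP st]]]] := @span_one R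
    [set e | exists l, iso_after_inverting (phi l) e]%classic.
  move=> p.
  have : (\bigcup_l range (spec_map (phi l)))%classic p by rewrite cov.
  move=> [l _ [q _ <-]]; have [e qe le] := open_immersion_local (opn l) q.
  by exists e => //; exists l.
apply: (covered_span local_algebra_comp _ st) => i.
have [l le] := sP i.
exists (loc_elt (phi l (s i))), (rcomp (phi l) (loc_elt_inj (phi l (s i)))).
split.
  exact: iso_after_inverting_loc le (is_loc_elt _).
exact: (small_eq local_algebra_comp) (small_at_iso le).
Qed.

Hypothesis U_contra : contraadjusted U.
Local Notation presents := (presents (@local_algebra) local_value).

(** A term [h] restricted along [alpha : S l -> B] contributes the value of [D l] on this
    restriction, as [local_value] may be computed through [alpha] itself. *)
Lemma presents_piece l g v (G : coind (phi l) U) :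
  presents (phi l) g v -> (forall x, G x = g x) -> v = D G 1.
Proof.
have DD x y : D (x + y) = D x + D y := diffopD x y (@D_diffop l).
move=> gv.
elim: gv G => {g v} [g g0|B psi alpha h g g' v _ alphaP hP gv IHg eg] G Gg.
  have -> : G = 0 by apply: coindP => x; rewrite Gg g0.
  have -> : D (0 : coind (phi l) U) = 0.
    by apply: (addrI (D 0)); rewrite -DD !addr0.
  by [].
have [H HE] := lin_coind (lin_comp alphaP hP).
have [G' G'E] := lin_coind (presents_lin gv).
have -> : G = H + G'.
  by apply: coindP => x; rewrite coind_addE Gg eg HE G'E.
rewrite DD coind_addE -(IHg _ G'E); congr (_ + _).
exact: local_valueE hP alphaP HE.
Qed.

(** A presentation of [r |-> r u], evaluated at 1, writes [u] as a finite sum of elements [G 1].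
    Additive maps on [U] are therefore determined by their values on these elements. *)
Lemma coind_eval_ind (P : U -> Prop) :
  P 0 -> (forall l (G : coind (phi l) U) u, P u -> P (G 1 + u)) ->
  forall u, P u.
Proof.
move=> P0 PD u.
have [tot _] := covered_presents U_contra local_algebra_comp local_valueD
  local_value_comp covered_base.
have [|v] := tot (fun r => r *: u).
  by move=> r x y; rewrite scalerDl scalerA.
suff gP g : presents (idfun : {rmorphism R -> R}) g v -> forall r, P (g r).
  by move=> /gP/(_ 1); rewrite scale1r.
elim=> {g v} [g g0 r|B psi alpha h g g' v [psiA _] alphaP hP _ IHg eg r].
  by rewrite g0.
have [l [sigma sigmaP]] := psiA; rewrite eg.
have [G GE] := lin_coind (lin_comp sigmaP hP).
have -> : h (alpha r) = (phi l r *: G) 1.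
  by rewrite coind_scaleE mulr1 GE sigmaP -alphaP.
exact: PD.
Qed.

(** [U] is [Hom_R(R, U)] through [u |-> (r |-> r u)], and [D0] is the extension of the local values
    there. The map attached to [G 1] is [G] restricted along [phi l], so a presentation of [G] over
    [S l], whose value is [D G 1], is also one over [R]. *)
Lemma glue_operators : exists D0 : U -> V,
  (forall x y, D0 (x + y) = D0 x + D0 y) /\
  forall l (G : coind (phi l) U), D G 1 = D0 (G 1).
Proof.
have [tot fct] := covered_presents U_contra local_algebra_comp local_valueD
  local_value_comp covered_base.
have scaleP (u : U) : lin (idfun : {rmorphism R -> R}) (fun r => r *: u).
  by move=> r x y; rewrite scalerDl scalerA.
have /boolp.choice[D0 D0P] :
    forall u : U, exists v, presents idfun (fun r => r *: u) v.
  by move=> u; apply: tot (scaleP u).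
have D0_unique u v : presents idfun (fun r => r *: u) v -> D0 u = v.
  move=> uv; apply/eqP; rewrite -subr_eq0; apply/eqP.
  apply: fct (presents_add (D0P u) (presents_opp local_valueD uv)) => r.
  by rewrite subrr.
exists D0; split=> [x y|l G].
  apply: D0_unique; have := presents_add (D0P x) (D0P y).
  by congr presents; apply/funext => r; rewrite scalerDr.
have [totl _] := covered_presents U_contra local_algebra_comp local_valueD
  local_value_comp (covered_piece l).
have [v Gv] := totl _ (coind_lin G).
rewrite -(presents_piece Gv (fun=> erefl)); apply/esym/D0_unique.
have -> : (fun r => r *: G 1) = fun r => G (phi l r).
  by apply/funext => r; rewrite -[in RHS](mulr1 (phi l r)) coindZ.
exact: presents_comp Gv.
Qed.

End Gluing.

Theorem proposition7p3 (K R : comPzRingType) (f : {rmorphism K -> R})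
  (n : nat) (S : 'I_n -> comPzRingType)
  (phi : forall l : 'I_n, {rmorphism R -> S l})
  (phi_cover : affine_open_covering phi)
  (U V : lmodType R) (U_contraadjusted : contraadjusted U)
  (D : forall l : 'I_n, coind (phi l) U -> coind (phi l) V)
  (D_diffop : forall l : 'I_n, diffop (rcomp f (phi l)) (D l))
  (D2 : forall j l : 'I_n,
     coind (rcomp (phi j) (tens_inl (phi j) (phi l))) U ->
     coind (rcomp (phi j) (tens_inl (phi j) (phi l))) V)
  (D2_induced : forall j l : 'I_n,
     induced (rcomp f (phi j)) (tens_inl (phi j) (phi l)) (D j)
       (fun g => coind_curry (D2 j l (coind_uncurry g))))
  (D2_compat : forall (j l : 'I_n)
     (h : coind (rcomp (phi l) (tens_inl (phi l) (phi j))) U),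
     D2 j l (coind_swap h)
       = coind_swap (D2 l j h)) :
  exists! D0 : U -> V,
    diffop f D0 /\ forall l : 'I_n, induced f (phi l) D0 (D l).
Proof.
have gen := coind_eval_ind D2_induced D2_compat D_diffop phi_cover
  U_contraadjusted.
have [D0 [D0D D0E]] := glue_operators D2_induced D2_compat D_diffop phi_cover
  U_contraadjusted.
have D00 : D0 0 = 0 by apply: (addrI (D0 0)); rewrite -D0D !addr0.
exists D0; split=> [|D1 [D1P D1_ind]].
  split=> [|l]; last by split; [exact: D_diffop | exact: D0E].
  have D0Z k (x : U) : D0 (f k *: x) = f k *: D0 x.
    elim/gen: x => [|l G u IHu]; first by rewrite scaler0 D00 scaler0.
    rewrite !(scalerDr, D0D) IHu; congr (_ + _).
    have evalZ (M : lmodType R) (H : coind (phi l) M) :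
      (phi l (f k) *: H) 1 = f k *: H 1 by rewrite coind_scaleE coindZ.
    by rewrite -!evalZ -!D0E (diffopZ k G (D_diffop l)) evalZ.
  split=> [k x y|r]; first by rewrite [LHS]D0D; congr (_ + _); apply: D0Z.
  have /boolp.choice[N NP] : forall l, exists N, forall g : coind (phi l) U,
      iter N.+1 (theta (phi l r)) (D l) g = 0.
    by move=> l; have [_ /(_ (phi l r))] := D_diffop l.
  (* There are finitely many [l], so one order serves all the [D l]. The iterate of [theta r] is
     additive, which leaves only elements [G 1] to check. *)
  exists (\max_l N l)%N; elim/gen=> [|l G u IHu].
    apply: (addrI (iter (\max_l N l).+1 (theta r) D0 0)).
    by rewrite -iter_thetaD ?addr0.
  rewrite iter_thetaD // IHu addr0 -(iter_theta_coind r _ _ (D0E l)).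
  by rewrite -(subnK (leq_bigmax l)) -addnS iter_theta_eq0 //; apply: NP.
(* Uniqueness: [D0] and [D1] are additive and both take the value [D l G 1] at [G 1]. *)
apply/funext; apply: gen => [|l G u IHu].
  by rewrite D00; apply: (addrI (D1 0)); rewrite -(diffopD _ _ D1P) !addr0.
by rewrite D0D (diffopD _ _ D1P) IHu -D0E; have [_ ->] := D1_ind l.
Qed.
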